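(* There is a (randomized, always correct) algorithm which, given as input any Proth number $N=2^e\cdot t+1$ (with $t$ odd and $2^e>t>0$), decides whether $N$ is prime, and whose expected running time and worst case running time are, respectively, $$\tilde{O}\big((t\log t+\log N)\log N\big)\qquad\text{and}\qquad \tilde{O}\big((t\log t+\log N)\log^2 N\big)$$ bit operations.
   Context: A Proth number is a positive integer of the form $N=2^e\cdot t+1$ with $t$ odd and $2^e>t>0$. Running time is counted in bit operations, with fast integer arithmetic (one multiplication or division modulo $N$ costs $\tilde O(\log N)$ bit operations). $f=\tilde O(g)$ means $f=O(g\cdot(\log g)^c)$ for some constant $c$. The algorithm may use random choices but always returns the correct answer; the expected running time on an input $N$ is the expectation over the algorithm's internal random choices, and the worst case running time is the maximum over those choices. No unproven hypothesis is assumed. *)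

(* Defs.v *)
From mathcomp Require Import all_boot all_order all_algebra.
From mathcomp Require Import all_classical all_reals all_analysis.

Set Implicit Arguments.
Unset Strict Implicit.
Unset Printing Implicit Defensive.
Import Order.TTheory GRing.Theory Num.Theory.

Local Open Scope ring_scope.

Record proth : Type := Proth {
  proth_e : nat;
  proth_t : nat;
  proth_odd : odd proth_t;
  proth_bound : (0 < proth_t < 2 ^ proth_e)%N }.

Coercion proth_val (N : proth) : nat := (2 ^ proth_e N * proth_t N + 1)%N.

(* The machine model is a random access machine with an unbounded memory of
   natural numbers of arbitrary size, structured control flow, indirect
   addressing and a coin-flipping instruction. Its running time is measured in
   bit operations (logarithmic cost): every operation is charged according to
   the binary lengths of all the numbers it handles, and a multiplication or
   division on operands of total length n is charged M n, where M is the bit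
   cost of the integer arithmetic in use. *)

Inductive arith := Add | Sub | Mul | Div | Mod.

(* [Read a] is the content of the memory cell whose address is the value of
   [a]; thus [Read (Const i)] is a variable. *)
Inductive expr :=
| Const of nat
| Read of expr
| Op of arith & expr & expr.

(* [Assign a e] stores the value of [e] in the cell whose address is the value
   of [a], and [Flip a] stores there the outcome (0 or 1) of a fair coin toss.
   The tests of [If] and [While] succeed on nonzero values. *)
Inductive cmd :=
| Skip
| Assign of expr & expr
| Flip of expr
| Seq of cmd & cmd
| If of expr & cmd & cmd
| While of expr & cmd.

Definition memory := nat -> nat.

Definition update (s : memory) (a v : nat) : memory :=
  fun i => if i == a then v else s i.

(* Subtraction is truncated; m %/ 0 = 0 and m %% 0 = m. *)
Definition arith_eval (o : arith) (m n : nat) : nat :=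
  match o with
  | Add => (m + n)%N
  | Sub => (m - n)%N
  | Mul => (m * n)%N
  | Div => (m %/ n)%N
  | Mod => (m %% n)%N
  end.

Fixpoint eval (s : memory) (e : expr) : nat :=
  match e with
  | Const n => n
  | Read a => s (eval s a)
  | Op o e1 e2 => arith_eval o (eval s e1) (eval s e2)
  end.

(* The number of binary digits of n, with bitlen 0 = 1. *)
Definition bitlen (n : nat) : nat := (trunc_log 2 n).+1.

Definition arith_cost (M : nat -> nat) (o : arith) (m n : nat) : nat :=
  match o with
  | Add | Sub => (bitlen m + bitlen n)%N
  | Mul | Div | Mod => M (bitlen m + bitlen n)%N
  end.

Fixpoint eval_cost (M : nat -> nat) (s : memory) (e : expr) : nat :=
  match e with
  | Const n => bitlen n
  | Read a => (eval_cost M s a + bitlen (eval s a) + bitlen (s (eval s a)))%N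
  | Op o e1 e2 => (eval_cost M s e1 + eval_cost M s e2
                   + arith_cost M o (eval s e1) (eval s e2))%N
  end.

(* The commands that remain to be executed, and the current memory. *)
Definition config : Type := (seq cmd * memory)%type.

Definition halted (x : config) : bool := nilp x.1.

(* One step; b is the outcome of the coin, used only by [Flip]. *)
Definition step (b : bool) (x : config) : config :=
  let s := x.2 in
  match x.1 with
  | [::] => x
  | c :: k =>
      match c with
      | Skip => (k, s)
      | Assign a e => (k, update s (eval s a) (eval s e))
      | Flip a => (k, update s (eval s a) (nat_of_bool b))
      | Seq c1 c2 => ([:: c1, c2 & k], s)
      | If e c1 c2 => ((if eval s e != 0%N then c1 else c2) :: k, s)
      | While e c1 => (if eval s e != 0%N then [:: c1, c & k] else k, s)
      end
  end.

Definition step_cost (M : nat -> nat) (x : config) : nat :=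
  let s := x.2 in
  match x.1 with
  | [::] => 0%N
  | c :: _ =>
      match c with
      | Skip => 1%N
      | Assign a e => (eval_cost M s a + eval_cost M s e
                       + bitlen (eval s a) + bitlen (eval s e))%N
      | Flip a => (eval_cost M s a + bitlen (eval s a) + 1)%N
      | Seq _ _ => 1%N
      | If e _ _ | While e _ => (eval_cost M s e + 1)%N
      end
  end.

(* The input is in cell 0, all other cells being 0. *)
Definition init (P : cmd) (N : nat) : config := ([:: P], update (fun=> 0%N) 0 N).

(* The configuration after n steps; the coin of step i (if needed) is w i. *)
Fixpoint run (P : cmd) (N : nat) (w : nat -> bool) (n : nat) : config :=
  match n with
  | 0 => init P N
  | n'.+1 => step (w n') (run P N w n')
  end.

(* For every outcome of the coins, P halts on N with answer a in cell 0. *)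
Definition answers (P : cmd) (N : nat) (a : bool) : Prop :=
  forall w : nat -> bool,
    exists n, halted (run P N w n) /\ (run P N w n).2 0%N = nat_of_bool a.

Definition cost_upto (M : nat -> nat) (P : cmd) (N : nat) (w : nat -> bool)
    (n : nat) : nat :=
  (\sum_(i < n) step_cost M (run P N w i))%N.

Definition running_time (R : realType) (M : nat -> nat) (P : cmd) (N : nat)
    (w : nat -> bool) : \bar R :=
  ereal_sup (range (fun n => (cost_upto M P N w n)%:R%:E)).

Definition worst_time (R : realType) (M : nat -> nat) (P : cmd) (N : nat) :
    \bar R :=
  ereal_sup (range (running_time R M P N)).

(* The expectation of [running_time] over independent fair coins. The cost of
   the first n steps depends only on the first n coins, so its expectation is
   the average over {0,1}^n; as this cost is nondecreasing in n, monotone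
   convergence makes the expected running time the supremum over n. *)
Definition mean_cost_upto (R : realType) (M : nat -> nat) (P : cmd) (N n : nat) :
    R :=
  (\sum_(w : n.-tuple bool) (cost_upto M P N (nth false w) n)%:R) / 2 ^+ n.

Definition expected_time (R : realType) (M : nat -> nat) (P : cmd) (N : nat) :
    \bar R :=
  ereal_sup (range (fun n => (mean_cost_upto R M P N n)%:E)).

(* f = O(g * (log g)^c) for some constant c, as the inputs i : I of the
   nonnegative functions f and g grow, i.e. as sz i tends to infinity. *)
Definition soft_O (R : realType) (I : Type) (sz : I -> nat)
    (f : I -> \bar R) (g : I -> R) : Prop :=
  exists c n0 : nat, exists C : R, forall i : I, (n0 <= sz i)%N ->
    (f i <= (C * (g i * ln (g i) ^+ c))%:E)%E.

(* Main.v *)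
Require Import Defs.
From mathcomp Require Import all_boot all_order all_algebra all_fingroup all_solvable all_field.
From mathcomp Require Import all_classical all_reals all_analysis.
From mathcomp Require Import zify ring lra.
Import Order.TTheory GRing.Theory Num.Theory.
Local Open Scope ring_scope.

Set Implicit Arguments.
Unset Strict Implicit.
Unset Printing Implicit Defensive.

(** Let N = 2^e t + 1. If a^(t 2^(e-1)) = -1 modulo N, every prime factor of N is 1
modulo 2^e, hence larger than the square root of N, and N is prime.

A random base a is conclusive with probability at least 1/4 in the strong
(Miller-Rabin) test: it satisfies the congruence above if N is prime, and proves N
composite otherwise. So e random trials cost O(log N) operations modulo N in the
mean, and all fail with probability at most (3/4)^e.

After e failures, a 2^e-th root of unity is computed deterministically, following
Sze. Start with alpha = 1. If N is prime and alpha = s^2, some a <= 2t + 2 is such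
that the t-th powers of a + s and a - s are nonzero with distinct squares; their
quotient has order 2^i with i >= 2, so that after some squarings the images
u + v s and u - v s have opposite squares, i.e. u^2 + alpha v^2 = 0. Then u / v is a
square root of -alpha, and replaces alpha. After e - 1 rounds -alpha is a primitive
2^e-th root of unity, for which the strong test must prove that N is prime. A round
takes O(t log t + log N) operations modulo N. If N is composite the computed number
is meaningless, and the strong test does not accept it.

All cells contain numbers at most 4N, so a step of the machine costs soft-O(log N). *)

(** * Bit lengths and the cost of a step *)

Section BitLength.
Local Open Scope nat_scope.

Lemma ltn_bitlen n : n < 2 ^ bitlen n.
Proof. exact: trunc_log_ltn. Qed.

Lemma bitlen_ub n k : 0 < k -> n < 2 ^ k -> bitlen n <= k.
Proof.
move=> k0 nk; rewrite /bitlen; case: (posnP n) => [->|n0]; first by rewrite trunc_log0.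
by rewrite -(ltn_exp2l _ _ (isT : 1 < 2)) (leq_ltn_trans (trunc_logP _ n0)).
Qed.

Lemma leq_bitlen m n : m <= n -> bitlen m <= bitlen n.
Proof. by move=> mn; rewrite ltnS leq_trunc_log. Qed.

Lemma bitlenM m n : bitlen (m * n) <= bitlen m + bitlen n.
Proof. by rewrite bitlen_ub // expnD ltn_mul // ltn_bitlen. Qed.

Lemma bitlenD m n : bitlen (m + n) <= bitlen m + bitlen n.
Proof.
rewrite bitlen_ub // expnD.
have := ltn_bitlen m; have := ltn_bitlen n.
have : 1 < 2 ^ bitlen m by rewrite -[X in X < _](expn0 2) ltn_exp2l.
have : 1 < 2 ^ bitlen n by rewrite -[X in X < _](expn0 2) ltn_exp2l.
nia.
Qed.

Lemma bitlen_arith o m n : bitlen (arith_eval o m n) <= bitlen m + bitlen n.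
Proof.
case: o => /=; rewrite ?bitlenD ?bitlenM //.
- by rewrite (leq_trans (leq_bitlen (leq_subr _ _))) ?leq_addr.
- by rewrite (leq_trans (leq_bitlen (leq_div _ _))) ?leq_addr.
- by rewrite (leq_trans (leq_bitlen (leq_mod _ _))) ?leq_addr.
Qed.

End BitLength.

(** * Cost of one machine step when all cells have boundedly many bits *)

Section StepCost.
Local Open Scope nat_scope.

(** A constant weighs its length and not 1, so that with cells of at most [bits] bits every value
    has at most [expr_size e * bits] bits. *)
Fixpoint expr_size (e : expr) : nat :=
  match e with
  | Const n => bitlen n
  | Read a => (expr_size a).+1
  | Op _ e1 e2 => (expr_size e1 + expr_size e2).+1
  end.

Fixpoint cmd_size (c : cmd) : nat :=
  match c with
  | Skip => 1
  | Assign a e => (expr_size a + expr_size e).+1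
  | Flip a => (expr_size a).+1
  | Seq c1 c2 => (cmd_size c1 + cmd_size c2).+1
  | If e c1 c2 => (expr_size e + cmd_size c1 + cmd_size c2).+1
  | While e c1 => (expr_size e + cmd_size c1).+1
  end.

Variables (M : nat -> nat) (bits : nat).
Hypothesis bits_gt0 : 0 < bits.

(** [M] may fail to be monotone, hence a maximum over all lengths up to [k * bits]; the first term
    pays for additions and memory accesses. *)
Definition op_bound (k : nat) := 2 * (k * bits) + \max_(m < (k * bits).+1) M m.

Lemma arith_cost_bound k o m n :
  bitlen m + bitlen n <= k * bits -> arith_cost M o m n <= op_bound k.
Proof.
move=> le_k; rewrite /op_bound.
have le_M : M (bitlen m + bitlen n) <= \max_(m < (k * bits).+1) M m.
  by rewrite -ltnS in le_k; apply: (leq_bigmax (Ordinal le_k)).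
case: o => /=; move: le_M le_k; set mx := \max_(_ < _) _; lia.
Qed.

Variable s : memory.
Hypothesis s_bits : forall i, bitlen (s i) <= bits.

Lemma bitlen_eval e : bitlen (Defs.eval s e) <= expr_size e * bits.
Proof.
elim: e => [n|a _|o e1 IH1 e2 IH2] /=; first by rewrite leq_pmulr.
  by rewrite mulSn (leq_trans (s_bits _)) ?leq_addr.
by rewrite (leq_trans (bitlen_arith _ _ _)) // mulSn mulnDl; lia.
Qed.

Lemma eval_cost_bound k e :
  expr_size e <= k -> eval_cost M s e <= expr_size e * op_bound k.
Proof.
have le_op j : j <= k -> 2 * (j * bits) <= op_bound k.
  by rewrite /op_bound => jk; have := leq_mul jk (leqnn bits); lia.
elim: e => [n|a IHa|o e1 IH1 e2 IH2] /= le_k.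
- rewrite -[X in X <= _]mul1n leq_mul //.
  have : bitlen n <= bitlen n * bits by rewrite leq_pmulr.
  by have := le_op _ le_k; lia.
- have := IHa (ltnW le_k); rewrite mulSn.
  have := bitlen_eval a; have := s_bits (Defs.eval s a).
  by have := le_op _ le_k; rewrite mulSn; lia.
- have e1k : expr_size e1 <= k by lia.
  have e2k : expr_size e2 <= k by lia.
  have : arith_cost M o (Defs.eval s e1) (Defs.eval s e2) <= op_bound k.
    apply: arith_cost_bound.
    have := leq_mul le_k (leqnn bits); rewrite mulSn mulnDl.
    by have := bitlen_eval e1; have := bitlen_eval e2; lia.
  by have := IH1 e1k; have := IH2 e2k; rewrite mulSn mulnDl; lia.
Qed.

Lemma step_cost_bound k (cs : seq cmd) :
  all (fun c => cmd_size c <= k) cs -> step_cost M (cs, s) <= 2 * k * op_bound k.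
Proof.
case: cs => [|c cs] //= /andP[ck _].
have k0 : 0 < k by case: (c) ck => //=; lia.
have opk : k * bits <= op_bound k by rewrite /op_bound; lia.
have op0 : 0 < op_bound k by rewrite (leq_trans _ opk) // muln_gt0 k0.
have cost e j : expr_size e + j <= k ->
    eval_cost M s e + bitlen (Defs.eval s e) + j <= 2 * (expr_size e + j) * op_bound k.
  move=> le_k.
  have ek : expr_size e <= k by lia.
  have := eval_cost_bound ek; have := bitlen_eval e.
  have := leq_mul (leqnn (expr_size e)) (leq_trans (leq_pmull bits k0) opk).
  by have := leq_mul (leqnn j) op0; lia.
case: c ck => [|a e|a|c1 c2|e c1 c2|e c1] /= ck; rewrite /step_cost /=.
- by rewrite muln_gt0 op0; lia.
- have := cost a 0 ltac:(lia); have := cost e 0 ltac:(lia).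
  by have := leq_mul ck (leqnn (op_bound k)); rewrite !addn0; lia.
- by have := cost a 1 ltac:(lia); have := leq_mul ck (leqnn (op_bound k)); lia.
- by rewrite muln_gt0 op0; lia.
- have le1 : expr_size e + 1 <= k by case: (c1) ck => //=; lia.
  have := cost e 1 le1.
  by have := leq_mul le1 (leqnn (op_bound k)); lia.
- have le1 : expr_size e + 1 <= k by lia.
  have := cost e 1 le1.
  by have := leq_mul le1 (leqnn (op_bound k)); lia.
Qed.

End StepCost.

(** * Executions *)

Section Executions.
Variable R : realType.

(** An arbitrary starting configuration allows inductions that peel off the first step instead of
    the last. *)
Fixpoint run_from (x : config) (w : nat -> bool) (n : nat) : config :=
  match n with
  | 0 => x
  | n'.+1 => step (w n') (run_from x w n')
  end.

Lemma run_fromE P N w n : run P N w n = run_from (init P N) w n.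
Proof. by elim: n => //= n ->. Qed.

Lemma run_fromS x w n :
  run_from x w n.+1 = run_from (step (w 0%N) x) (fun i => w i.+1) n.
Proof. by elim: n => //= n ->. Qed.

Variable M : nat -> nat.

Definition cost_from x w n : nat := (\sum_(i < n) step_cost M (run_from x w i))%N.

Lemma cost_fromS x w n :
  cost_from x w n.+1 =
    (step_cost M x + cost_from (step (w 0%N) x) (fun i => w i.+1) n)%N.
Proof.
rewrite /cost_from big_ord_recl; congr addn.
by apply: eq_bigr => i _; rewrite lift0 run_fromS.
Qed.

Definition mean_from x n : R :=
  (\sum_(w : n.-tuple bool) (cost_from x (nth false w) n)%:R) / 2 ^+ n.

Lemma big_tuple_cons n (F : n.+1.-tuple bool -> R) :
  \sum_(w : n.+1.-tuple bool) F w =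
    \sum_(w : n.-tuple bool) F (cons_tuple false w) +
    \sum_(w : n.-tuple bool) F (cons_tuple true w).
Proof.
rewrite (reindex (fun p : bool * n.-tuple bool => cons_tuple p.1 p.2)) /=; last first.
  exists (fun w : n.+1.-tuple bool => (thead w, [tuple of behead w])).
    by move=> [b w] _ /=; congr pair; apply: val_inj.
  by move=> w _; apply: val_inj; rewrite /= [in RHS](tuple_eta w).
rewrite -(pair_bigA _ (fun b w => F (cons_tuple b w))) /= big_bool addrC //.
Qed.

(** Conditioning on the first coin. A coin is drawn at every step, whether or not the command reads
    it. *)
Lemma mean_fromS x n :
  mean_from x n.+1 = (step_cost M x)%:R +
    (mean_from (step false x) n + mean_from (step true x) n) / 2.
Proof.
have half b : \sum_(w : n.-tuple bool)
      (cost_from x (nth false (cons_tuple b w)) n.+1)%:R =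
    (step_cost M x)%:R * 2 ^+ n + mean_from (step b x) n * 2 ^+ n :> R.
  rewrite /mean_from mulfVK ?expf_neq0 ?pnatr_eq0 //.
  under eq_bigr do rewrite cost_fromS natrD.
  rewrite big_split /= sumr_const card_tuple card_bool -[_ *+ (2 ^ n)]mulr_natr natrX.
  by congr (_ + _).
rewrite /mean_from big_tuple_cons !half -/(mean_from _ _) -/(mean_from _ _).
have : (2 : R) ^+ n != 0 by rewrite expf_neq0 ?pnatr_eq0.
by rewrite exprS; move: (2 ^+ n) => z z0; field.
Qed.

Variables (B : nat) (ans : nat).

(* [T] bounds the number of steps for all outcomes of the coins, and [v] its
   expectation. *)
Inductive halts_within : nat -> R -> config -> Prop :=
| halts_now T v s : s 0%N = ans -> 0 <= v -> halts_within T v ([::], s)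
| halts_step T v v0 v1 c k s :
    (forall i, (s i <= B)%N) ->
    halts_within T v0 (step false (c :: k, s)) ->
    halts_within T v1 (step true (c :: k, s)) ->
    1 + (v0 + v1) / 2 <= v ->
    halts_within T.+1 v (c :: k, s).

Lemma halts_within_leq T T' v v' x :
  (T <= T')%N -> v <= v' -> halts_within T v x -> halts_within T' v' x.
Proof.
move=> leT lev H; elim: H T' v' leT lev => {T v x} [T v s|T v v0 v1 c k s].
  by move=> s0 v0 T' v' _ vv'; apply: halts_now => //; apply: le_trans vv'.
move=> sB H0 IH0 H1 IH1 v01 [|T'] v' //= TT' vv'.
apply: halts_step (IH0 _ _ _ (lexx _)) (IH1 _ _ _ (lexx _)) _ => //.
exact: le_trans vv'.
Qed.

Lemma halts_within_ge0 T v x : halts_within T v x -> 0 <= v.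
Proof.
elim=> {T v x} // T v v0 v1 c k s _ _ v0_ge0 _ v1_ge0; apply: le_trans.
by rewrite addr_ge0 ?divr_ge0 ?addr_ge0.
Qed.

Lemma halts_withinP T v x w : halts_within T v x ->
  exists n, halted (run_from x w n) /\ (run_from x w n).2 0%N = ans.
Proof.
move=> H; elim: H w => {T v x} [T v s s0 _|T v v0 v1 c k s _ _ IH0 _ IH1 _] w.
  by exists 0%N.
have [n Hn] : exists n, let y := run_from (step (w 0%N) (c :: k, s)) (fun i => w i.+1) n in
    halted y /\ y.2 0%N = ans.
  by case: (w 0%N); [apply: IH1|apply: IH0].
by exists n.+1; rewrite run_fromS.
Qed.

Lemma halted_cost n x w : halted x -> cost_from x w n = 0%N.
Proof.
case: x => [[|c k] s] // _; apply: big1 => i _.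
by have -> : run_from ([::], s) w i = ([::], s) by elim: (nat_of_ord i) => //= m ->.
Qed.

(** Only subcommands of the program are ever pending, so one constant bounds the size of all
    commands executed. *)
Lemma step_size K x b :
  all (fun c => cmd_size c <= K)%N x.1 -> all (fun c => cmd_size c <= K)%N (step b x).1.
Proof.
case: x => [[|[|a e|a|c1 c2|e c1 c2|e c1] k] s] //= /andP[cK kK];
  rewrite ?kK //; last (case: ifP => _ //=; rewrite kK); try case: ifP => _; lia.
Qed.

Variable K : nat.
Let U := (2 * K * op_bound M (bitlen B) K)%N.

Let step_cost_le x : (forall i, (x.2 i <= B)%N) ->
  all (fun c => cmd_size c <= K)%N x.1 -> (step_cost M x <= U)%N.
Proof.
by case: x => cs s /= sB csK; apply: step_cost_bound csK => // i; apply: leq_bitlen.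
Qed.

Lemma halts_within_cost T v x w n :
  halts_within T v x -> all (fun c => cmd_size c <= K)%N x.1 ->
  (cost_from x w n <= U * T)%N.
Proof.
move=> H; elim: H w n => {T v x} [T v s _ _|T v v0 v1 c k s sB _ IH0 _ IH1 _] w n xK.
  by rewrite halted_cost.
case: n => [|n]; first by rewrite /cost_from big_ord0.
rewrite cost_fromS mulnS leq_add ?step_cost_le //.
have := @step_size _ _ (w 0%N) xK.
by case: (w 0%N) => ?; [apply: IH1|apply: IH0].
Qed.

(** The recursion [mean_fromS] matches the condition [1 + (v0 + v1) / 2 <= v] of [halts_step], with
    each step charged [U]. *)
Lemma halts_within_mean T v x n :
  halts_within T v x -> all (fun c => cmd_size c <= K)%N x.1 ->
  mean_from x n <= U%:R * v.
Proof.
move=> H; elim: H n => {T v x} [T v s _ v0|T v v0 v1 c k s sB H0 IH0 H1 IH1 v01] n xK.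
  rewrite /mean_from big1 ?mul0r ?mulr_ge0 ?ler0n // => w _.
  by rewrite halted_cost.
case: n => [|n].
  rewrite /mean_from big1 ?mul0r => [|w _]; last by rewrite /cost_from big_ord0.
  apply: mulr_ge0; rewrite ?ler0n //; apply: le_trans v01.
  by rewrite addr_ge0 ?divr_ge0 ?addr_ge0 ?(halts_within_ge0 H0) ?(halts_within_ge0 H1).
rewrite mean_fromS.
have := IH0 n (step_size _ xK); have := IH1 n (step_size _ xK).
have : (step_cost M (c :: k, s))%:R <= U%:R :> R by rewrite ler_nat step_cost_le.
have : U%:R * (1 + (v0 + v1) / 2) <= U%:R * v by rewrite ler_wpM2l ?ler0n.
lra.
Qed.

Lemma worst_time_le T v P N :
  halts_within T v (init P N) -> (cmd_size P <= K)%N ->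
  (worst_time R M P N <= (U * T)%:R%:E)%E.
Proof.
move=> H PK; apply: ge_ereal_sup => _ [w _ <-]; apply: ge_ereal_sup => _ [n _ <-].
rewrite lee_fin ler_nat /cost_upto; under eq_bigr do rewrite run_fromE.
by apply: halts_within_cost H _ => /=; rewrite PK.
Qed.

Lemma expected_time_le T v P N :
  halts_within T v (init P N) -> (cmd_size P <= K)%N ->
  (expected_time R M P N <= (U%:R * v)%:E)%E.
Proof.
move=> H PK; apply: ge_ereal_sup => _ [n _ <-]; rewrite lee_fin.
suff -> : mean_cost_upto R M P N n = mean_from (init P N) n.
  by apply: halts_within_mean H _ => /=; rewrite PK.
congr (_ / _); apply: eq_bigr => w _; congr _%:R; apply: eq_bigr => i _.
by rewrite run_fromE.
Qed.

End Executions.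

(** * Modular arithmetic and the strong test *)

Section PrimeField.
Variable p : nat.
Hypothesis p_pr : prime p.

Lemma natr_Fp_eq m n : (m%:R == n%:R :> 'F_p) = (m == n %[mod p])%N.
Proof. by rewrite -val_eqE /= !val_Fp_nat. Qed.

Lemma natr_Fp_eq0 m : (m%:R == 0 :> 'F_p) = (p %| m)%N.
Proof. by rewrite -[0]/(0%:R) natr_Fp_eq mod0n. Qed.

Lemma natr_Fp_eqN1 m : (m%:R == -1 :> 'F_p) = (p %| m.+1)%N.
Proof. by rewrite -natr_Fp_eq0 -natr1 addr_eq0. Qed.

Lemma Fp_fermat (x : 'F_p) : x != 0 -> x ^+ p.-1 = 1.
Proof.
move=> x0; apply: (mulfI x0); rewrite mulr1 -exprS prednK ?prime_gt0 //.
by have := expf_card x; rewrite card_Fp.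
Qed.

Lemma Fp_generator : exists2 g : 'F_p, g != 0 &
  (forall x, x != 0 -> exists i, x = g ^+ i) /\
  (forall i, (g ^+ i == 1) = (p.-1 %| i)%N).
Proof.
have /cyclicP[g gP] := field_unit_group_cyclic [set: {unit 'F_p}].
have og : #[g]%g = p.-1 by rewrite orderE -gP card_finField_unit card_Fp.
exists (val g); first by rewrite -unitfE (valP g).
split=> [x x0|i].
  have ux : x \is a GRing.unit by rewrite unitfE.
  have /cycleP[i xi] : FinRing.Unit ux \in <[g]>%g by rewrite -gP inE.
  by exists i; rewrite -FinRing.val_unitX -xi.
by rewrite -FinRing.val_unitX (val_eqE (g ^+ i)%g 1%g) -order_dvdn og.
Qed.

(** Euler's criterion: when [x] is written as a power of a generator, the hypothesis forces an even
    exponent. *)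
Lemma Fp_square (x : 'F_p) :
  odd p -> x != 0 -> x ^+ p.-1./2 = 1 -> exists s, s ^+ 2 = x.
Proof.
move=> p_odd x0; have [g g0 [/(_ _ x0)[i ->] ordg]] := Fp_generator.
rewrite -exprM => /eqP; rewrite ordg => dvd_i.
suff /dvdnP[k ->] : (2 %| i)%N by exists (g ^+ k); rewrite -exprM.
have p1 := prime_gt1 p_pr; move: dvd_i.
have [h0 {1}->] : (0 < p.-1./2)%N /\ p.-1 = (p.-1./2 * 2)%N by split; lia.
by rewrite [(i * _)%N]mulnC dvdn_pmul2l.
Qed.

(** Under repeated squaring, the last value different from 1 is a square root of 1, hence -1. *)
Lemma sqr_eq1 (F : fieldType) (x : F) n : x ^+ (2 ^ n) = 1 -> x != 1 ->
  exists2 i, (i < n)%N & x ^+ (2 ^ i) = -1.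
Proof.
elim: n => [|n IHn]; first by rewrite expr1 => -> /eqP.
rewrite expnSr exprM => /eqP; rewrite sqrf_eq1 => /orP[/eqP xn x1|/eqP xn _].
  by have [i lt_in xi] := IHn xn x1; exists i; rewrite // ltnW.
by exists n.
Qed.

End PrimeField.

Section ModularRing.
Variable n : nat.
Hypothesis n_gt1 : (1 < n)%N.

Lemma natr_Zp_eq k m : (k%:R == m%:R :> 'Z_n) = (k == m %[mod n])%N.
Proof. by rewrite -val_eqE /= !val_Zp_nat. Qed.

Lemma natr_Zp_eq0 m : (m%:R == 0 :> 'Z_n) = (n %| m)%N.
Proof. by rewrite -[0]/(0%:R) natr_Zp_eq mod0n. Qed.

Lemma natr_Zp_eqN1 m : (m%:R == -1 :> 'Z_n) = (n %| m.+1)%N.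
Proof. by rewrite -natr_Zp_eq0 -natr1 addr_eq0. Qed.

Lemma coprime_exp1 y k : (0 < k)%N -> (y ^ k = 1 %[mod n])%N -> coprime y n.
Proof.
move=> k0 yk; rewrite -(coprime_pexpl _ _ k0) -coprime_modl yk coprime_modl.
exact: coprime1n.
Qed.

End ModularRing.

(** * The strong test modulo a Proth number: soundness and density of conclusive bases *)

Section Proth.
Variables (e t : nat).
Hypotheses (t_odd : odd t) (t_gt0 : (0 < t)%N) (t_lt : (t < 2 ^ e)%N).
Let N := (2 ^ e * t + 1)%N.

Lemma proth_e_gt0 : (0 < e)%N.
Proof. by case: (e) t_lt => //; case: (t) t_gt0. Qed.
Local Notation e_gt0 := proth_e_gt0.

Let N_half : N.-1 = (t * 2 ^ e.-1 * 2)%N.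
Proof. by rewrite /N addn1 /= -mulnA -expnSr prednK ?e_gt0 // mulnC. Qed.

Let N_odd : odd N.
Proof. by rewrite /N oddD oddM oddX /= -leqn0 leqNgt e_gt0. Qed.

Let N_gt2 : (2 < N)%N.
Proof. by case: (N) N_odd N_half => [|[|[|]]] //= _; have := expn_gt0 2 e.-1; nia. Qed.

(** Otherwise q - 1 = 2^l d with d odd and l <= m. The d-th power of a^(k 2^m) is then -1, since d
    is odd, and 1 by Fermat, since q - 1 divides the exponent. *)
Lemma dvdn_pred_minus1_power q a k m :
  prime q -> (2 < q)%N -> (q %| (a ^ (k * 2 ^ m)).+1)%N -> (2 ^ m.+1 %| q.-1)%N.
Proof.
move=> q_pr q2 dvd_q; have q1 := prime_gt1 q_pr.
rewrite pfactor_dvdn //; last by lia.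
rewrite ltnNge; apply/negP => le_m.
have a_m1 : a%:R ^+ (k * 2 ^ m) = -1 :> 'F_q.
  by apply/eqP; rewrite -natrX natr_Fp_eqN1.
have neq1N1 : (-1 : 'F_q) != 1.
  rewrite eq_sym -addr_eq0 -(mulr2n 1) natr_Fp_eq0 //.
  by apply/negP => /dvdn_leq; lia.
have a0 : a%:R != 0 :> 'F_q.
  apply: contra_eq_neq a_m1 => ->; rewrite expr0n eq_sym.
  by case: (_ == 0%N); rewrite // oppr_eq0 oner_eq0.
set l := logn 2 q.-1 in le_m.
have [d d_odd qE] : exists2 d, odd d & q.-1 = (2 ^ l * d)%N.
  have [||d] := @pfactor_coprime 2 q.-1 => //; first by lia.
  by rewrite coprime2n => oo qo; exists d; rewrite // mulnC.
have : (a%:R ^+ (k * 2 ^ m)) ^+ d = 1 :> 'F_q.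
  have -> : (k * 2 ^ m = k * 2 ^ (m - l) * 2 ^ l)%N.
    by rewrite -mulnA -expnD subnK.
  by rewrite -exprM -mulnA -qE mulnC exprM Fp_fermat // expr1n.
by rewrite a_m1 -signr_odd d_odd expr1; apply/eqP.
Qed.

(** Proth's criterion: the least prime factor exceeds 2^e, so its square exceeds N because t <
    2^e. *)
Lemma proth_prime a : (N %| (a ^ (t * 2 ^ e.-1)).+1)%N -> prime N.
Proof.
move=> dvdN; apply/negPn/negP => N_npr.
have q_pr : prime (pdiv N) by apply: pdiv_prime; lia.
have q_odd : odd (pdiv N) by apply: dvdn_odd (pdiv_dvd _) N_odd.
have q2 : (2 < pdiv N)%N by have := prime_gt1 q_pr; case: (pdiv N) q_odd => [|[|[|]]].
have := dvdn_pred_minus1_power q_pr q2 (dvdn_trans (pdiv_dvd _) dvdN).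
rewrite prednK ?e_gt0 // => /dvdn_leq le_q.
have lt_q : (2 ^ e < pdiv N)%N by have := le_q ltac:(lia); lia.
have : (pdiv N ^ 2 <= N)%N.
  by rewrite leqNgt; apply/negP => /ltn_pdiv2_prime H; case/negP: N_npr; apply: H; lia.
move: lt_q; move: (pdiv N) => q; rewrite /N; move: (2 ^ e)%N t_lt => d; nia.
Qed.

(* The strong test on base [a] is inconclusive: the sequence of the
   [a ^ (t * 2 ^ i)] modulo [N] either starts with 1, or meets -1 before the last
   place, where -1 would prove primality. *)
Definition undecided (a : nat) : bool :=
  (a ^ t == 1 %[mod N])%N || [exists i : 'I_e.-1, N %| (a ^ (t * 2 ^ i)).+1]%N.

Lemma undecided_modn a : undecided (a %% N) = undecided a.
Proof.
rewrite /undecided modnXm; congr (_ || _); apply: eq_existsb => i.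
by rewrite -addn1 /dvdn -modnDml modnXm modnDml addn1.
Qed.

Lemma undecided_fermat a : undecided a -> (a ^ (t * 2 ^ e.-1) = 1 %[mod N])%N.
Proof.
case/orP => [/eqP at1|/existsP[i dvdN]].
  by rewrite expnM -modnXm at1 modnXm exp1n.
have -> : (t * 2 ^ e.-1 = t * 2 ^ i * 2 * 2 ^ (e.-1 - i.+1))%N.
  by rewrite -!mulnA -expnS -expnD; congr (_ * 2 ^ _)%N; have := ltn_ord i; lia.
rewrite expnM -modnXm expnM.
suff -> : ((a ^ (t * 2 ^ i)) ^ 2 = 1 %[mod N])%N by rewrite modnXm exp1n.
apply/eqP; move: dvdN; move: (a ^ _)%N => [|b] dvdN; first by move: dvdN; rewrite dvdn1; lia.
rewrite eqn_mod_dvd ?expn_gt0 // -[1%N](exp1n 2) subn_sqr.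
by rewrite addn1 dvdn_mull.
Qed.

Lemma strong_test_prime a : prime N -> ~~ (N %| a)%N ->
  (a ^ t == 1 %[mod N])%N \/ exists2 i, (i < e)%N & (N %| (a ^ (t * 2 ^ i)).+1)%N.
Proof.
move=> N_pr Na; case: eqP => [|/eqP at1]; [by left|right].
rewrite -natr_Fp_eq // natrX in at1.
have a0 : a%:R != 0 :> 'F_N by rewrite natr_Fp_eq0.
have [|i lt_i ai] := @sqr_eq1 _ (a%:R ^+ t : 'F_N) e _ at1.
  rewrite -exprM -[RHS](Fp_fermat N_pr a0) N_half -mulnA -expnSr prednK //.
  exact: e_gt0.
by exists i => //; rewrite -natr_Fp_eqN1 // natrX exprM ai.
Qed.


Let N_gt1 : (1 < N)%N := ltnW N_gt2.

(** The last hypothesis says that no base meets -1 after place [j]. An undecided base is thus 1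
    throughout, or meets -1 at [j], or meets it earlier and has been squared to 1 by then. *)
Lemma undecided_exp_sign a j : undecided a -> (j < e)%N ->
  (forall i b, (i < e)%N -> (N %| (b ^ (t * 2 ^ i)).+1)%N -> (i <= j)%N) ->
  (a%:R ^+ (t * 2 ^ j) : 'Z_N) = 1 \/ (a%:R ^+ (t * 2 ^ j) : 'Z_N) = -1.
Proof.
move=> ua lt_je maxj; case/orP: ua => [|/existsP[i dvd_i]].
  by rewrite -natr_Zp_eq // natrX exprM => /eqP ->; left; rewrite expr1n.
have lt_ie : (i < e)%N by have := ltn_ord i; lia.
have := maxj _ _ lt_ie dvd_i; move: dvd_i; rewrite -natr_Zp_eqN1 // natrX => /eqP ai.
rewrite leq_eqVlt => /orP[/eqP <-|lt_ij]; [by right|left].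
have -> : (t * 2 ^ j = t * 2 ^ i * 2 * 2 ^ (j - i.+1))%N.
  by rewrite -!mulnA -expnS -expnD; congr (_ * 2 ^ _)%N; lia.
by rewrite exprM [X in X ^+ _]exprM ai sqrrN !expr1n.
Qed.

(* Multiplication by [y] is then an injection from the inconclusive bases to the
   others. *)
Lemma undecided_shift : exists2 y, coprime y N &
  forall a, undecided a -> undecided (y * a) -> False.
Proof.
have [N_pr|N_npr] := boolP (prime N).
  (* For N prime the shift is a generator g: by [undecided_fermat] for both bases, g^((N - 1) / 2)
     would be 1. *)
  have [g g0 [_ ordg]] := Fp_generator N_pr.
  exists (val g) => [|a ua uga].
    by rewrite coprime_sym prime_coprime // -natr_Fp_eq0 // natr_Zp.
  have /eqP := undecided_fermat ua; have /eqP := undecided_fermat uga.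
  rewrite -!natr_Fp_eq // !natrX natrM natr_Zp exprMn => /eqP + /eqP a1.
  rewrite a1 mulr1 => /eqP; rewrite ordg N_half => /dvdn_leq.
  by rewrite muln_gt0 t_gt0 expn_gt0 /= => /(_ isT); have := expn_gt0 2 e.-1; nia.
set p := pdiv N; have p_pr : prime p by rewrite pdiv_prime.
have p_odd : odd p by apply: dvdn_odd (pdiv_dvd _) N_odd.
have p_gt2 : (2 < p)%N by have := prime_gt1 p_pr; case: (p) p_odd => [|[|[|]]].
set m := (N %/ p)%N; have NE : N = (m * p)%N by rewrite divnK ?pdiv_dvd.
have m_gt1 : (1 < m)%N.
  rewrite ltnNge; apply/negP => m1; case/negP: N_npr; rewrite NE.
  have -> : m = 1%N by have := N_gt1; rewrite NE; case: (m) m1 => [|[|]].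
  by rewrite mul1n.
have [p_m|p_m] := boolP (p %| m)%N.
  (* [p ^ 2] divides [N]: then the order of [1 + N / p] divides [N], hence not [N - 1]. *)
  set z : 'Z_N := m%:R.
  have zz : z * z = 0.
    by apply/eqP; rewrite -natrM natr_Zp_eq0 // NE dvdn_mul.
  have N0 : N%:R = 0 :> 'Z_N by apply/eqP; rewrite natr_Zp_eq0.
  have y_exp n : (1 + z) ^+ n = 1 + z * n%:R.
    by elim: n => [|n IHn]; rewrite ?mulr0 ?addr0 // exprS IHn -natr1; ring: zz.
  have yN : (m.+1)%:R ^+ N = 1 :> 'Z_N.
    by rewrite -natr1 addrC y_exp N0 mulr0 addr0.
  exists m.+1 => [|a ua uya].
    apply: (@coprime_exp1 _ _ N); rewrite // ?(ltnW N_gt1) //.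
    by apply/eqP; rewrite -natr_Zp_eq // natrX yN.
  have /eqP := undecided_fermat ua; have /eqP := undecided_fermat uya.
  rewrite -!natr_Zp_eq // !natrX natrM exprMn => /eqP + /eqP a1.
  rewrite a1 mulr1 => y1; have yN1 : (m.+1)%:R ^+ N.-1 = 1 :> 'Z_N.
    by rewrite N_half exprM y1 expr1n.
  move: yN; rewrite -[X in _ ^+ X](ltn_predK N_gt1) exprS yN1 mulr1 => /eqP.
  rewrite -subr_eq0 -natr1 addrK natr_Zp_eq0 // => /dvdn_leq.
  by move=> /(_ (ltnW m_gt1)); rewrite {1}NE leqNgt ltn_Pmulr // ltnW.
(* Otherwise take [j] maximal such that some [x ^ (t * 2 ^ j)] is -1: this power is
   a sign on inconclusive bases, but not on the [y] congruent to [x] modulo [p] and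
   to 1 modulo [m]. *)
have co_pm : coprime p m by rewrite prime_coprime.
pose P j := (j < e)%N && [exists x : 'I_N, N %| (x ^ (t * 2 ^ j)).+1]%N.
have P_bound j : P j -> (j <= e)%N by case/andP => /ltnW.
have [|j /andP[lt_je /existsP[x dvd_x]] maxj] := @ex_maxnP P e _ P_bound.
  (* The set of places is nonempty: as [t] is odd, the base -1 meets -1 at place 0. *)
  exists 0%N; rewrite /P e_gt0; apply/existsP.
  have lt_N : (N.-1 < N)%N by rewrite ltn_predL ltnW.
  exists (Ordinal lt_N); rewrite -natr_Zp_eqN1 // natrX /=.
  have /eqP -> : N.-1%:R == -1 :> 'Z_N by rewrite natr_Zp_eqN1 // (ltn_predK N_gt1).
  by rewrite expn0 muln1 -signr_odd t_odd.
set k := (t * 2 ^ j)%N in dvd_x.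
have k_gt0 : (0 < k)%N by rewrite muln_gt0 t_gt0 expn_gt0.
pose y := chinese p m x 1.
have yp : (p %| (y ^ k).+1)%N.
  rewrite -addn1 /dvdn -modnDml -modnXm chinese_modl // modnXm modnDml addn1.
  by apply: dvdn_trans dvd_x; rewrite NE dvdn_mull.
have ym : (y ^ k = 1 %[mod m])%N.
  by rewrite -modnXm chinese_modr // modnXm exp1n.
have maxj' i b : (i < e)%N -> (N %| (b ^ (t * 2 ^ i)).+1)%N -> (i <= j)%N.
  move=> lt_ie dvd_b; apply: maxj; rewrite /P lt_ie; apply/existsP.
  exists (Ordinal (ltn_pmod b (ltnW N_gt1))); rewrite /=.
  by rewrite -addn1 /dvdn -modnDml modnXm modnDml addn1.
exists y => [|a ua uya].
  apply: (@coprime_exp1 _ _ (k * 2)); first by rewrite muln_gt0 k_gt0.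
  apply/eqP; rewrite NE chinese_remainder 1?coprime_sym //; apply/andP; split; apply/eqP.
    by rewrite expnM -modnXm ym modnXm.
  apply/eqP; rewrite -natr_Fp_eq //; move: yp; rewrite -natr_Fp_eqN1 // natrX => /eqP yN1.
  by rewrite natrX exprM yN1 sqrrN expr1n.
(* Being a quotient of signs, y^k is a sign modulo N. It is not 1, being -1 modulo the odd p, and
   not -1, being 1 modulo the odd m > 1. *)
have yk_sign : (y ^ k)%:R = 1 :> 'Z_N \/ (y ^ k)%:R = -1 :> 'Z_N.
  rewrite natrX; have := undecided_exp_sign uya lt_je maxj'.
  rewrite natrM exprMn.
  by case: (undecided_exp_sign ua lt_je maxj') => ->; rewrite ?mulr1 // mulrN1;
    case=> /(congr1 -%R); rewrite !opprK; [right|left].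
case: yk_sign => /eqP.
  rewrite -[1]/(1%:R) natr_Zp_eq // => /eqP yk1.
  have ykp : (y ^ k = 1 %[mod p])%N.
    by rewrite -(modn_dvdm _ (pdiv_dvd N)) yk1 modn_dvdm ?pdiv_dvd.
  by move: yp; rewrite -addn1 /dvdn -modnDml ykp modnDml => /dvdn_leq; lia.
rewrite natr_Zp_eqN1 // => dvdN; have {dvdN} : (m %| (y ^ k).+1)%N.
  by apply: dvdn_trans dvdN; rewrite NE dvdn_mulr.
rewrite -addn1 /dvdn -modnDml ym modnDml => /dvdn_leq m2.
by have := N_odd; rewrite NE oddM p_odd andbT; have := m2 isT; case: (m) m_gt1 => [|[|[|]]].
Qed.

Definition inconclusive (a : nat) : bool := (N %| a)%N || undecided a.

(** Multiplication by the [y] of [undecided_shift] injects the nonzero undecided residues into the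
    conclusive ones, which are thus at least half of the N - 1 nonzero residues. *)
Lemma card_conclusive : (N.-1 <= 2 * #|[set a : 'I_N | ~~ inconclusive a]|)%N.
Proof.
have [y co_y y_shift] := undecided_shift.
have N_gt0 : (0 < N)%N := ltnW N_gt1.
pose f (a : 'I_N) := Ordinal (ltn_pmod (y * a) N_gt0).
have f_inj : injective f.
  move=> a b /(congr1 val) /= /eqP.
  rewrite -!natr_Zp_eq // !natrM => /eqP /mulrI.
  rewrite unitZpE // coprime_sym => /(_ co_y) /eqP.
  by rewrite natr_Zp_eq // !modn_small // => /eqP /val_inj.
set G := [set a | _]; pose X := [set a : 'I_N | (0 < a)%N && undecided a].
have N_a (a : 'I_N) : (N %| a)%N = (a == 0 :> nat).
  by case: (posnP a) => [->|a0]; rewrite ?dvdn0 // gtnNdvd // gtn_eqF.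
have leXG : (#|X| <= #|G|)%N.
  rewrite -(card_imset _ f_inj); apply: subset_leq_card.
  apply/fintype.subsetP => _ /imsetP[a + ->]; rewrite !inE => /andP[a0 ua].
  rewrite /inconclusive /= undecided_modn negb_or; apply/andP; split.
    rewrite /dvdn modn_mod; apply/negP => ya.
    have := f_inj a (Ordinal N_gt0); rewrite /f /= => /(_ _)/(congr1 val)/= a00.
    move: a0; rewrite a00 //; apply: val_inj => /=.
    by rewrite muln0 mod0n; apply/eqP.
  by apply/negP => uya; apply: y_shift ua uya.
have : (#|[set a : 'I_N | (0 < a)%N]| <= #|X| + #|G|)%N.
  apply: leq_trans (leq_card_setU _ _); apply: subset_leq_card.
  apply/fintype.subsetP => a; rewrite !inE /inconclusive N_a lt0n => a0.
  by rewrite a0 (negPf a0); case: undecided.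
have : (#|~: [set a : 'I_N | (0 < a)%N]| <= 1)%N.
  apply: (@leq_trans #|[set Ordinal N_gt0]|); last by rewrite cards1.
  apply/subset_leq_card/fintype.subsetP => a; rewrite !inE -leqNgt leqn0 => a0.
  exact/eqP/val_inj/eqP.
have := cardsC [set a : 'I_N | (0 < a)%N]; rewrite card_ord; lia.
Qed.

(** Here [n] is the range of the random draw. At least (N - 1) / 2 >= n / 4 of its elements are
    conclusive. *)
Lemma sum_inconclusive n : (N <= n)%N -> (n <= 2 * N.-1)%N ->
  (4 * \sum_(r < n) inconclusive r <= 3 * n)%N.
Proof.
move=> le_N lt_n.
have split_n : (\sum_(r < n) inconclusive r + \sum_(r < n) ~~ inconclusive r = n)%N.
  rewrite -big_split /= -[RHS]card_ord -sum1_card; apply: eq_bigr => r _.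
  by case: inconclusive.
have : (\sum_(r < N) ~~ inconclusive r <= \sum_(r < n) ~~ inconclusive r)%N.
  rewrite -!(big_mkord xpredT (fun r => nat_of_bool (~~ inconclusive r))).
  by rewrite (big_cat_nat _ le_N) //= leq_addr.
have -> : (\sum_(r < N) ~~ inconclusive r)%N = #|[set a : 'I_N | ~~ inconclusive a]|.
  by rewrite -sum1dep_card [RHS]big_mkcond; apply: eq_bigr => r _; case: inconclusive.
move: card_conclusive split_n; move: #|_| (\sum_(r < n) inconclusive r)%N.
by move: (\sum_(r < n) _)%N => *; lia.
Qed.

End Proth.

(** * Square roots modulo a Proth prime *)

Section SquareRoots.
Variables (e t : nat).
Hypotheses (t_odd : odd t) (t_gt0 : (0 < t)%N) (t_lt : (t < 2 ^ e)%N).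
Let p := (2 ^ e * t + 1)%N.
Hypothesis p_pr : prime p.
Local Notation F := 'F_p.
Implicit Types (s u v x : F).

Let e_gt0 : (0 < e)%N := proth_e_gt0 t_gt0 t_lt.

Let p_half : p.-1 = (2 ^ e.-1 * t * 2)%N.
Proof. by rewrite /p addn1 /= -[X in (2 ^ X * _)%N](prednK e_gt0) expnS; lia. Qed.

Let p_odd : odd p.
Proof. by rewrite /p oddD oddM oddX /= -leqn0 leqNgt e_gt0. Qed.

Lemma Fp_two_neq0 : 2 != 0 :> F.
Proof.
rewrite natr_Fp_eq0 // dvdn_prime2 //; apply/eqP => p2.
by move: p_odd; rewrite p2.
Qed.

(** Squaring gives x^(2^(k+1)) = 1, and 2^(k+1) divides (p - 1) / 2 = 2^(e-1) t, so Euler's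
    criterion applies. *)
Lemma square_of_root x k : (k.+1 < e)%N -> (- x) ^+ (2 ^ k) = -1 -> exists2 s, s ^+ 2 = x & s != 0.
Proof.
move=> lt_ke xk; have x0 : x != 0.
  apply: contra_eq_neq xk => ->; rewrite oppr0 expr0n expn_eq0 /=.
  by rewrite eq_sym oppr_eq0 oner_eq0.
have xk1 : x ^+ (2 ^ k.+1) = 1.
  by rewrite expnS exprM -sqrrN -exprM mulnC exprM xk sqrrN expr1n.
have [] := @Fp_square _ p_pr x p_odd x0 _; last first.
  by move=> s sx; exists s => //; apply: contra_neq x0 => s0; rewrite -sx s0 expr0n.
have -> : p.-1./2 = (2 ^ k.+1 * 2 ^ (e.-1 - k.+1) * t)%N.
  by rewrite p_half muln2 doubleK -expnD subnKC //; lia.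
by rewrite -mulnA exprM xk1 expr1n.
Qed.

(* The polynomial [((X + s)^(2t) - (X - s)^(2t)) (X^2 - s^2)] has degree at most
   [2t + 2], and its first factor does not vanish at [s]. *)
Lemma separating_base s : s != 0 -> (1 < e)%N -> exists2 a, (a < 2 * t + 3)%N &
  a%:R ^+ 2 != s ^+ 2 /\ ((a%:R + s) ^+ t) ^+ 2 != ((a%:R - s) ^+ t) ^+ 2.
Proof.
move=> s0 e_gt1.
pose P := (('X + s%:P) ^+ (t * 2) - ('X - s%:P) ^+ (t * 2)) * ('X^2 - (s ^+ 2)%:P).
have P0 : P != 0.
  rewrite mulf_neq0 //; last by rewrite -size_poly_gt0 size_XnsubC.
  apply: contraTneq isT => /(congr1 (horner^~ s)).
  rewrite !hornerE subrr expr0n muln_eq0 orbF -leqn0 leqNgt t_gt0 subr0 => /eqP.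
  by rewrite expf_eq0 -mulr2n -mulr_natl mulf_eq0 (negPf Fp_two_neq0) (negPf s0) andbF.
have sizeP : (size P <= 2 * t + 3)%N.
  rewrite (leq_trans (size_polyMleq _ _)) // size_XnsubC //.
  suff : (size (('X + s%:P) ^+ (t * 2) - ('X - s%:P) ^+ (t * 2))%R <= t * 2 + 1)%N by lia.
  rewrite (leq_trans (size_polyD _ _)) // size_polyN geq_max.
  by rewrite -{1}[s]opprK polyCN !size_exp_XsubC addn1 leqnn.
pose rs : seq F := [seq a%:R | a <- iota 0 (2 * t + 3)].
(* Since e > 1, p >= 4 t + 1 >= 2 t + 3, and the candidates are distinct modulo p. *)
have le_p : (2 * t + 3 <= p)%N.
  have : (2 ^ 2 <= 2 ^ e)%N by rewrite leq_exp2l.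
  by rewrite /p; nia.
have uniq_rs : uniq rs.
  rewrite map_inj_in_uniq ?iota_uniq // => a b; rewrite !mem_iota /= => lt_a lt_b.
  by move=> /eqP; rewrite natr_Fp_eq // !modn_small => [/eqP||]; lia.
have /negP/allPn[_ /mapP[a a_lt ->] Pa] : ~ all (root P) rs.
  by move=> /(max_poly_roots P0) /(_ uniq_rs); rewrite size_map size_iota ltnNge sizeP.
exists a; first by move: a_lt; rewrite mem_iota.
move: Pa; rewrite /root !hornerE mulf_eq0 negb_or !subr_eq0 => /andP[? ?].
by rewrite -!exprM.
Qed.

(* With [s ^+ 2] the current root of unity, [u + v X] modulo [X^2 - s^2] is known
   through its values [u + v s] and [u - v s]. *)
Definition opposite_squares_after s j u v : Prop :=
  [/\ u + v * s != 0, u - v * s != 0 & exists2 i, (i < j)%N &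
   (u + v * s) ^+ (2 ^ i.+1) = - (u - v * s) ^+ (2 ^ i.+1)].

(** The ratio r of the two values is a t-th power, so r^(2^e) = 1 by Fermat. Moreover r^2 != 1, the
    squares of the values differing by 4 u v s. Repeated squaring of r^2 therefore meets -1. *)
Lemma opposite_squares_init s a u v :
  u + v * s = (a%:R + s) ^+ t -> u - v * s = (a%:R - s) ^+ t ->
  u != 0 -> v != 0 -> a%:R ^+ 2 != s ^+ 2 -> s != 0 ->
  opposite_squares_after s e u v.
Proof.
move=> Huv Huv' u0 v0 as2 s0.
have [a1 a2] : a%:R + s != 0 /\ a%:R - s != 0.
  by move: as2; rewrite -subr_eq0 subr_sqr mulf_eq0 negb_or => /andP[].
have A0 : u + v * s != 0 by rewrite Huv expf_neq0.
have B0 : u - v * s != 0 by rewrite Huv' expf_neq0.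
split=> //.
set r := (u + v * s) / (u - v * s).
have r2 : r ^+ 2 != 1.
  rewrite /r expr_div_n; apply: contra_neqN u0 => /eqP r1.
  have : (u + v * s) ^+ 2 - (u - v * s) ^+ 2 = 0.
    by rewrite -[X in X - _](divfK (expf_neq0 2 B0)) r1 mul1r subrr.
  have -> : (u + v * s) ^+ 2 - (u - v * s) ^+ 2 = 2 * 2 * u * v * s by ring.
  by move/eqP; rewrite !mulf_eq0 (negPf Fp_two_neq0) (negPf v0) (negPf s0) !orbF /= => /eqP.
have re : (r ^+ 2) ^+ (2 ^ e) = 1.
  rewrite -exprM mulnC exprM /r expr_div_n Huv Huv' -!exprM.
  have -> : (t * 2 ^ e = p.-1)%N by rewrite /p addn1 mulnC.
  by rewrite !Fp_fermat // divr1 expr1n.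
have [i lt_ie ri] := sqr_eq1 re r2; exists i => //.
move: ri; rewrite -exprM -expnS expr_div_n => /(canRL (divfK (expf_neq0 _ B0))).
by rewrite mulN1r.
Qed.

(** The new pair is the square of u + v X, so the place [i] drops by one. It was not 0 already: the
    squares of the two values add up to 2 (u^2 + s^2 v^2). *)
Lemma opposite_squares_step s j u v :
  opposite_squares_after s j u v -> u ^+ 2 + s ^+ 2 * v ^+ 2 != 0 ->
  opposite_squares_after s j.-1 (u ^+ 2 + s ^+ 2 * v ^+ 2) (u * v + v * u).
Proof.
move=> [A0 B0 [i lt_ij Hi]] uv0.
have EA : u ^+ 2 + s ^+ 2 * v ^+ 2 + (u * v + v * u) * s = (u + v * s) ^+ 2 by ring.
have EB : u ^+ 2 + s ^+ 2 * v ^+ 2 - (u * v + v * u) * s = (u - v * s) ^+ 2 by ring.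
rewrite /opposite_squares_after EA EB !expf_neq0 //; split=> //.
case: i lt_ij Hi => [|i] lt_ij Hi; last first.
  by exists i; [lia|rewrite -!exprM -!expnS].
case/negP: uv0; have : 2 * (u ^+ 2 + s ^+ 2 * v ^+ 2) = 0.
  have -> : 2 * (u ^+ 2 + s ^+ 2 * v ^+ 2) = (u + v * s) ^+ 2 + (u - v * s) ^+ 2 by ring.
  by move: Hi; rewrite expn1 => ->; rewrite addNr.
by move/eqP; rewrite mulf_eq0 (negPf Fp_two_neq0).
Qed.

(** By Fermat v^(p-2) is the inverse of v; if v were 0, then u would be 0 too, against the nonzero
    values. *)
Lemma opposite_squares_sqrt s j u v :
  opposite_squares_after s j u v -> s != 0 -> u ^+ 2 + s ^+ 2 * v ^+ 2 = 0 ->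
  (u * v ^+ (p - 2)) ^+ 2 = - s ^+ 2.
Proof.
move=> [A0 B0 _] s0 uv0; have v0 : v != 0.
  apply: contra_neq A0 => v0; move: uv0; rewrite v0 expr0n mulr0 addr0 mul0r addr0.
  by move/eqP; rewrite expf_eq0 => /eqP.
have vV : v ^+ (p - 2) * v = 1.
  by rewrite -exprSr -(Fp_fermat p_pr v0); congr (_ ^+ _); have := prime_gt1 p_pr; lia.
have : (u * v ^+ (p - 2)) ^+ 2 * v ^+ 2 = - s ^+ 2 * v ^+ 2.
  by rewrite -exprMn -mulrA vV mulr1 mulNr; apply/eqP; rewrite -addr_eq0 uv0.
by apply: mulIf; rewrite expf_neq0.
Qed.

End SquareRoots.

(** * The program *)

Section Runs.
Local Open Scope nat_scope.
Variables (R : realType) (B ans T : nat) (v : R).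

(* The memory is the list [l], followed by zeros. *)
Definition runs (n : nat) (k : seq cmd) (l : seq nat) : Prop :=
  all (leq^~ B) l -> halts_within B ans (n + T) (n%:R + v)%R (k, nth 0 l).

Lemma runs_leq m n k l : m <= n -> runs m k l -> runs n k l.
Proof.
move=> le_mn H lB; apply: halts_within_leq (H lB); first by rewrite leq_add2r.
by rewrite lerD2r ler_nat.
Qed.

Lemma nth_bounded l i : all (leq^~ B) l -> nth 0 l i <= B.
Proof.
by move=> lB; have [lt_i|le_i] := ltnP i (size l); [exact: (all_nthP 0 lB)|rewrite nth_default].
Qed.

(** Both outcomes of the coin lead to the same configuration, so a deterministic step adds one to
    the worst and to the mean number of steps alike. *)
Lemma runs_step n c k k' l l' : 0 < n ->
  (forall b, step b (c :: k, nth 0 l) = (k', nth 0 l')) ->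
  (all (leq^~ B) l -> all (leq^~ B) l') -> runs n.-1 k' l' -> runs n (c :: k) l.
Proof.
case: n => // n _ stepE l'B H lB.
have H' := H (l'B lB).
apply: (@halts_step _ _ _ _ _ (n%:R + v) (n%:R + v)); rewrite ?stepE //.
  by move=> i; apply: nth_bounded.
by rewrite -(natr1 n); lra.
Qed.

Lemma runs_skip n k l : 0 < n -> runs n.-1 k l -> runs n (Skip :: k) l.
Proof. by move=> n0; apply: runs_step. Qed.

Lemma runs_seq n c1 c2 k l : 0 < n ->
  runs n.-1 [:: c1, c2 & k] l -> runs n (Seq c1 c2 :: k) l.
Proof. by move=> n0; apply: runs_step. Qed.

Lemma runs_if n e c1 c2 k l : 0 < n ->
  runs n.-1 ((if Defs.eval (nth 0 l) e != 0 then c1 else c2) :: k) l ->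
  runs n (If e c1 c2 :: k) l.
Proof. by move=> n0; apply: runs_step. Qed.

Lemma runs_while n e c k l : 0 < n ->
  runs n.-1 (if Defs.eval (nth 0 l) e != 0 then [:: c, While e c & k] else k) l ->
  runs n (While e c :: k) l.
Proof. by move=> n0; apply: runs_step. Qed.

Lemma update_nth l i x : update (nth 0 l) i x = nth 0 (set_nth 0 l i x).
Proof. by apply/funext => j; rewrite nth_set_nth /= /update. Qed.

Lemma set_nth_bounded l i x : x <= B -> all (leq^~ B) l -> all (leq^~ B) (set_nth 0 l i x).
Proof.
move=> xB lB; apply/(all_nthP 0) => j _; rewrite nth_set_nth /=.
by case: eqP => // _; apply: nth_bounded.
Qed.

Lemma runs_assign n i e k l : 0 < n ->
  (all (leq^~ B) l -> Defs.eval (nth 0 l) e <= B) ->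
  runs n.-1 k (set_nth 0 l i (Defs.eval (nth 0 l) e)) ->
  runs n (Assign (Const i) e :: k) l.
Proof.
move=> n0 eB; apply: runs_step => // [b|lB]; first by rewrite -update_nth.
by apply: set_nth_bounded => //; apply: eB.
Qed.

End Runs.

Local Notation "$ i" := (Read (Const i)) (at level 5, format "$ i").
Local Notation "i <~ x" := (Assign (Const i) x) (at level 70).
Local Notation "c1 ;; c2" := (Seq c1 c2) (at level 80, right associativity).
Local Notation "x [+] y" := (Op Add x y) (at level 50, left associativity).
Local Notation "x [-] y" := (Op Defs.Sub x y) (at level 50, left associativity).
Local Notation "x [*] y" := (Op Mul x y) (at level 40, left associativity).
Local Notation "x [/] y" := (Op Div x y) (at level 40, left associativity).
Local Notation "x [%] y" := (Op Mod x y) (at level 40, left associativity).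

(* Cells: 0: N; 1, 2: t, e with N = 2^e t + 1; 3: the parameter alpha of the ring
   Z/N[X]/(X^2 - alpha); 4, 5: x + y X, the base of a power; 6: its exponent;
   7, 8: u + v X, its value; 9: the number under test; 11: the verdict, 0 if
   unknown, 1 if N is prime, 2 if it is composite; 12, 13: loop counters;
   10, 14: temporaries. *)
Definition power_loop : cmd :=
  While ($6)
    (If ($6 [%] Const 2)
       (14 <~ ($7 [*] $4 [+] $3 [*] ($8 [*] $5)) [%] $0 ;;
        8 <~ ($7 [*] $5 [+] $8 [*] $4) [%] $0 ;;
        7 <~ $14)
       Skip ;;
     14 <~ ($4 [*] $4 [+] $3 [*] ($5 [*] $5)) [%] $0 ;;
     5 <~ ($4 [*] $5 [+] $5 [*] $4) [%] $0 ;;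
     4 <~ $14 ;;
     6 <~ $6 [/] Const 2).

Definition power : cmd := 7 <~ Const 1 ;; 8 <~ Const 0 ;; power_loop.

(** Products act as conjunctions and truncated differences as comparisons: the loop goes on while
    the counter is nonzero and cell 7, reduced modulo N, is not N - 1. *)
Definition squaring_loop : cmd :=
  While ($13 [*] (($0 [-] Const 1) [-] $7))
    (7 <~ ($7 [*] $7) [%] $0 ;; 13 <~ $13 [-] Const 1).

(** With alpha = 0 and no X term, [power] computes in Z/N. The sum of two truncated differences
    tests for being different from 1. A -1 met with a nonzero counter comes before the last place
    and leaves the verdict unknown. *)
Definition strong_test : cmd :=
  3 <~ Const 0 ;; 4 <~ $9 ;; 5 <~ Const 0 ;; 6 <~ $1 ;; power ;;
  If (($7 [-] Const 1) [+] (Const 1 [-] $7))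
    (13 <~ $2 [-] Const 1 ;;
     squaring_loop ;;
     If (($0 [-] Const 1) [-] $7)
       (11 <~ Const 2)
       (If ($13) Skip (11 <~ Const 1)))
    Skip.

(** Bases are tried downwards until u, v and a^2 - alpha are all nonzero modulo N. Adding N before
    subtracting alpha avoids truncation. *)
Definition base_search : cmd :=
  While ($9 [*] (Const 1 [-] $7 [*] $8 [*] (($9 [*] $9 [+] $0 [-] $3) [%] $0)))
    (9 <~ $9 [-] Const 1 ;; 4 <~ $9 ;; 5 <~ Const 1 ;; 6 <~ $1 ;; power).

Definition norm_loop : cmd :=
  While ($13 [*] (($7 [*] $7 [+] $3 [*] ($8 [*] $8)) [%] $0))
    (14 <~ ($7 [*] $7 [+] $3 [*] ($8 [*] $8)) [%] $0 ;;
     8 <~ ($7 [*] $8 [+] $8 [*] $7) [%] $0 ;;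
     7 <~ $14 ;;
     13 <~ $13 [-] Const 1).

(* If N is prime and alpha is a square, replaces alpha by a square root of
   -alpha. *)
Definition square_root : cmd :=
  9 <~ Const 2 [*] $1 [+] Const 3 ;;
  7 <~ Const 0 ;;
  base_search ;;
  13 <~ $2 ;;
  norm_loop ;;
  10 <~ $7 ;; 4 <~ $8 ;; 5 <~ Const 0 ;; 6 <~ $0 [-] Const 2 ;;
  power ;;
  3 <~ ($10 [*] $7) [%] $0.

Definition root_loop : cmd :=
  While ($12) (12 <~ $12 [-] Const 1 ;; square_root).

Definition root_of_unity_test : cmd :=
  3 <~ Const 1 ;; 12 <~ $2 [-] Const 1 ;; root_loop ;; 9 <~ $0 [-] $3 ;; strong_test.

(** Binary digits are drawn until the range, a power of two in cell 10, reaches N. *)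
Definition draw_loop : cmd :=
  While ($0 [-] $10)
    (Flip (Const 14) ;; 9 <~ $9 [+] $9 [+] $14 ;; 10 <~ $10 [+] $10).

Definition random_tests : cmd :=
  While ($12 [*] (Const 1 [-] $11))
    (12 <~ $12 [-] Const 1 ;;
     9 <~ Const 0 ;; 10 <~ Const 1 ;; draw_loop ;;
     If ($9 [%] $0) strong_test Skip).

Definition factor_loop : cmd :=
  While (($1 [+] Const 1) [%] Const 2) (1 <~ $1 [/] Const 2 ;; 2 <~ $2 [+] Const 1).

(** The final remainder sends verdict 1 to yes, and both 2 and a remaining 0 to no: after the root
    of unity, no prime is left without a proof. *)
Definition proth_test : cmd :=
  1 <~ $0 [-] Const 1 ;;
  factor_loop ;;
  12 <~ $2 ;;
  random_tests ;;
  If ($11) Skip root_of_unity_test ;;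
  0 <~ $11 [%] Const 2.

(* The numerical constants in the step counts below are rough upper bounds. *)
Section ProgramCorrectness.
Local Open Scope nat_scope.
Variables (e t : nat).
Hypotheses (t_odd : odd t) (t_gt0 : 0 < t) (t_lt : t < 2 ^ e).
Let N := 2 ^ e * t + 1.
Let B := 4 * N.

Let e_gt0 : 0 < e := proth_e_gt0 t_gt0 t_lt.

Let N_gt2 : 2 < N.
Proof. by have : 2 ^ 1 <= 2 ^ e; [rewrite leq_exp2l|rewrite /N expn1; nia]. Qed.

Variables b c : nat.
Hypotheses (t_lt_b : t < 2 ^ b) (N_lt_c : N < 2 ^ c).

Variable R : realType.

Let ltn_modN m : m %% N < N.
Proof. by rewrite ltn_pmod //; lia. Qed.

Let leq_modB m : m %% N <= B.
Proof. by have := ltn_modN m; rewrite /B; lia. Qed.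

Ltac bounded_value :=
  move=> /=; rewrite ?leq_modB //;
  first [by rewrite /B; lia | by case/and10P | by rewrite /B; move=> bnd; have := nth_bounded 9 bnd; lia].
Ltac run_assign := apply: runs_assign => /=; [by lia|by bounded_value|].
Ltac run_seq := apply: runs_seq => /=; first by lia.
Ltac run_skip := apply: runs_skip => /=; first by lia.
Ltac run_if := apply: runs_if => /=; first by lia.
Ltac run_while := apply: runs_while => /=; first by lia.

(** * Correctness and step counts of the deterministic parts of the program *)

Section Deterministic.
Variables (ans T : nat) (w0 : R).
Local Notation runs := (runs B ans T w0).

(* [u' + v' X = (u + v X) (x + y X) ^ h] modulo [N] and [X ^ 2 - alpha]. *)
Definition power_from alpha u v x y h u' v' : Prop :=
  forall (A : comNzRingType) (s : A), (N%:R = 0 :> A)%R -> (s ^+ 2 = alpha%:R)%R ->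
    (u'%:R + v'%:R * s = (u%:R + v%:R * s) * (x%:R + y%:R * s) ^+ h)%R.

Lemma natr_modn (A : pzRingType) m : (N%:R = 0 :> A -> (m %% N)%:R = m%:R :> A)%R.
Proof. by move=> N0; rewrite [in RHS](divn_eq m N) natrD natrM N0 mulr0 add0r. Qed.

Lemma power_loop_ok m n k al x y h u v a3 a4 a5 a6 a7 a8 :
  h < 2 ^ m -> u < N -> v < N ->
  (forall x' y' u' v' a8', u' < N -> v' < N ->
    power_from al u v x y h u' v' ->
    runs n k [:: N; t; e; al; x'; y'; 0; u'; v'; a3; a4; a5; a6; a7; a8']) ->
  runs (20 * m + 1 + n) (power_loop :: k) [:: N; t; e; al; x; y; h; u; v; a3; a4; a5; a6; a7; a8].
Proof.
elim: m x y h u v a8 => [|m IHm] x y h u v a8 h_lt uN vN H.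
  have h0 : h = 0 by lia.
  rewrite h0 in H *; apply: runs_while => /=; first by lia.
  apply: (@runs_leq _ _ _ _ _ n); first by lia.
  by apply: H => // A s _ _; rewrite expr0 mulr1.
have [h0|h_gt0] := posnP h.
  rewrite h0 in H *; apply: runs_while => /=; first by lia.
  apply: (@runs_leq _ _ _ _ _ n); first by lia.
  by apply: H => // A s _ _; rewrite expr0 mulr1.
have h2 : h %/ 2 < 2 ^ m by rewrite ltn_divLR // -expnSr.
apply: runs_while => /=; first by lia.
rewrite -lt0n h_gt0.
apply: runs_seq; first by lia.
apply: runs_if => /=; first by lia.
set rest := (X in runs _ (_ :: X :: _)).
(* Both branches end by squaring the base and halving the exponent, once the digit [h %% 2] has been
   absorbed in [u1] and [v1]. *)
have tail u1 v1 a : u1 < N -> v1 < N -> power_from al u v x y (h %% 2) u1 v1 ->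
    runs (20 * m + 8 + n) [:: rest, power_loop & k]
      [:: N; t; e; al; x; y; h; u1; v1; a3; a4; a5; a6; a7; a].
  move=> u1N v1N Huv; rewrite /rest; do 3 (run_seq; run_assign); run_assign.
  apply: runs_leq (IHm _ _ _ _ _ _ h2 u1N v1N _); first by lia.
  move=> x' y' u' v' a' u'N v'N Huv'; apply: H => // A s N0 sal.
  have -> : ((x%:R + y%:R * s) ^+ h =
      ((x%:R + y%:R * s) ^+ 2) ^+ (h %/ 2) * (x%:R + y%:R * s) ^+ (h %% 2))%R.
    by rewrite -exprM mulnC -exprD -divn_eq.
  rewrite (Huv' A s N0 sal) (Huv A s N0 sal) -mulrA; congr (_ * _)%R.
  rewrite mulrC; congr (_ ^+ _ * _)%R.
  rewrite !natr_modn // !(natrD, natrM) -sal; ring.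
case: (h %% 2 =P 0) => [h0|h1] /=.
  run_skip; apply: runs_leq (tail _ _ _ uN vN _); first by lia.
  by move=> A s _ _; rewrite h0 expr0 mulr1.
run_seq; run_assign; run_seq; run_assign; run_assign.
apply: runs_leq (tail _ _ _ (ltn_modN _) (ltn_modN _) _); first by lia.
move=> A s N0 sal; have -> : h %% 2 = 1 by move: h1; rewrite modn2; case: odd.
rewrite !natr_modn // !(natrD, natrM) -sal; ring.
Qed.

Lemma power_ok m n k al x y h a1 a2 a3 a4 a5 a6 a7 a8 : h < 2 ^ m ->
  (forall x' y' u' v' a8', u' < N -> v' < N -> power_from al 1 0 x y h u' v' ->
    runs n k [:: N; t; e; al; x'; y'; 0; u'; v'; a3; a4; a5; a6; a7; a8']) ->
  runs (20 * m + 5 + n) (power :: k)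
    [:: N; t; e; al; x; y; h; a1; a2; a3; a4; a5; a6; a7; a8].
Proof.
move=> h_lt H; rewrite /power; do 2 (run_seq; run_assign).
by apply: runs_leq (power_loop_ok h_lt _ _ H); lia.
Qed.

Lemma sub_modn_eq0 m : (N - 1 - m %% N == 0) = (N %| m.+1).
Proof.
have mN := ltn_modN m.
rewrite {2}(divn_eq m N) -addnS dvdn_addr ?dvdn_mull //.
apply/idP/idP => [|/dvdn_leq]; last by lia.
by move=> ?; have -> : (m %% N).+1 = N by lia.
Qed.

Definition no_minus1_before i a := forall j, j < i -> ~~ (N %| (a ^ (t * 2 ^ j)).+1).

Lemma squaring_loop_ok i j n k a1 a2 a3 a4 a5 r a7 a8 a9 a10 :
  i + j = e.-1 -> no_minus1_before i r ->
  (forall i' j', i' + j' = e.-1 -> no_minus1_before i' r ->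
    j' = 0 \/ N %| (r ^ (t * 2 ^ i')).+1 ->
    runs n k [:: N; t; e; a1; a2; a3; a4; r ^ (t * 2 ^ i') %% N; a5; r; a7; a8; a9; j'; a10]) ->
  runs (10 * j + 1 + n) (squaring_loop :: k)
    [:: N; t; e; a1; a2; a3; a4; r ^ (t * 2 ^ i) %% N; a5; r; a7; a8; a9; j; a10].
Proof.
elim: j i => [|j IHj] i ij no_i H.
  run_while; apply: (@runs_leq _ _ _ _ _ n); first by lia.
  by apply: H => //; left.
run_while; rewrite muln_eq0 sub_modn_eq0 /=; case: ifPn => [dvd_i|]; last first.
  rewrite negbK => dvd_i; apply: (@runs_leq _ _ _ _ _ n); first by lia.
  by apply: H => //; right.
run_seq; run_assign; run_assign.
rewrite modnMml modnMmr -expnD addnn -muln2 -mulnA -expnSr subn1 /=.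
apply: runs_leq (IHj i.+1 _ _ H); [by lia|by lia|].
by move=> l; rewrite ltnS leq_eqVlt => /orP[/eqP ->|/no_i].
Qed.

Variant strong_test_result a : nat -> Prop :=
| Inconclusive of undecided e t a : strong_test_result a 0
| ProvedPrime of N %| (a ^ (t * 2 ^ e.-1)).+1 : strong_test_result a 1
| ProvedComposite of a ^ t != 1 %[mod N] & no_minus1_before e a : strong_test_result a 2.

Lemma strong_test_ok n k a1 a2 a3 a4 a5 a6 r a7 a8 a9 a10 :
  (forall x y u v res j w, strong_test_result r res -> res <= 2 ->
    runs n k [:: N; t; e; 0; x; y; 0; u; v; r; a7; res; a8; j; w]) ->
  runs (20 * b + 10 * e + 30 + n) (strong_test :: k)
    [:: N; t; e; a1; a2; a3; a4; a5; a6; r; a7; 0; a8; a9; a10].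
Proof.
move=> H; rewrite /strong_test; do 4 (run_seq; run_assign); run_seq.
apply: (@runs_leq _ _ _ _ _ (20 * b + 5 + (10 * e + 15 + n))); first by lia.
apply: power_ok t_lt_b _ => x y u v a u_lt v_lt pow_u.
(* As alpha = 0, the invariant of [power] can be evaluated at the root 0 of Z/N. *)
have {pow_u} -> : u = r ^ t %% N.
  rewrite -(modn_small u_lt); apply/eqP; rewrite -natr_Zp_eq; last by lia.
  have N0 : (N%:R = 0 :> 'Z_N)%R by apply/eqP; rewrite natr_Zp_eq0 ?dvdnn; lia.
  have := pow_u 'Z_N 0%R N0; rewrite expr0n => /(_ erefl).
  by rewrite !mulr0 !addr0 mul1r natrX => ->.
run_if; case: ifPn => [u1|u1]; last first.
  run_skip; apply: (@runs_leq _ _ _ _ _ n); first by lia.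
  apply: H => //; apply: Inconclusive; apply/orP; left.
  by rewrite -[(2 ^ e * t + 1)%N]/N (@modn_small 1); lia.
have rt1 : r ^ t != 1 %[mod N] by rewrite (@modn_small 1); lia.
run_seq; run_assign; run_seq.
have -> : r ^ t %% N = r ^ (t * 2 ^ 0) %% N by rewrite muln1.
rewrite subn1; apply: (@runs_leq _ _ _ _ _ (10 * e.-1 + 1 + (5 + n))); first by lia.
apply: squaring_loop_ok => // i j ij no_i stop.
run_if; rewrite sub_modn_eq0; case: ifPn => [ndvd|].
  run_assign; apply: (@runs_leq _ _ _ _ _ n); first by lia.
  apply: H => //; apply: ProvedComposite => // l le.
  (* The loop did not stop at -1, so it ran through all places up to e - 1. *)
  have j0 : j = 0 by case: stop => // dvd_i; rewrite dvd_i in ndvd.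
  have : l <= i by rewrite j0 addn0 in ij; rewrite ij -ltnS prednK.
  by rewrite leq_eqVlt => /orP[/eqP ->|/no_i].
rewrite negbK => dvd_i; run_if; case: ifPn => [j_gt0|].
  run_skip; apply: (@runs_leq _ _ _ _ _ n); first by lia.
  apply: H => //; apply: Inconclusive; apply/orP; right; apply/existsP.
  have lt_i : i < e.-1 by lia.
  by exists (Ordinal lt_i).
rewrite negbK => /eqP j0; run_assign; apply: (@runs_leq _ _ _ _ _ n); first by lia.
by apply: H => //; apply: ProvedPrime; rewrite -ij j0 addn0.
Qed.

Definition usable_base al a u v : Prop :=
  [/\ power_from al 1 0 a 1 t u v, u%:R != 0 :> 'F_N, v%:R != 0 :> 'F_N &
    a%:R ^+ 2 != al%:R :> 'F_N]%R.

Definition has_root al : Prop := exists2 s : 'F_N, (s ^+ 2 = al%:R)%R & (s != 0)%R.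

Let N0_Fp (N_pr : prime N) : (N%:R = 0 :> 'F_N)%R.
Proof. by apply/eqP; rewrite natr_Fp_eq0. Qed.

(** The invariant holds for every root of alpha, in particular for both [s] and [- s]. *)
Lemma power_from_conj al x y h u v (s : 'F_N) : prime N -> (s ^+ 2 = al%:R)%R ->
  power_from al 1 0 x y h u v ->
  (u%:R + v%:R * s = (x%:R + y%:R * s) ^+ h)%R /\ (u%:R - v%:R * s = (x%:R - y%:R * s) ^+ h)%R.
Proof.
move=> N_pr sal pow; split.
  by have := pow 'F_N s (N0_Fp N_pr) sal; rewrite mul0r addr0 mul1r.
have := pow 'F_N (- s)%R (N0_Fp N_pr); rewrite sqrrN => /(_ sal).
by rewrite !mulrN mul0r subr0 mul1r.
Qed.

(** If u or v were 0, the values u + v s and u - v s would have equal squares, against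
    [separating_base]. *)
Lemma usable_base_exists al : prime N -> 1 < e -> has_root al ->
  exists2 a, a < 2 * t + 3 & forall u v, power_from al 1 0 a 1 t u v -> usable_base al a u v.
Proof.
move=> N_pr e_gt1 [s sal s0].
have [a a_lt [as2 AB]] := separating_base t_odd t_gt0 t_lt N_pr s0 e_gt1.
exists a => // u v pow; have [] := power_from_conj N_pr sal pow.
rewrite mul1r => HA HB; rewrite -HA -HB in AB; rewrite sal in as2; split=> //.
  by apply: contra_neq AB => ->; rewrite add0r sub0r sqrrN.
by apply: contra_neq AB => ->; rewrite mul0r addr0 subr0.
Qed.

Lemma sub_modn_Fp r al : prime N -> al < N -> (r * r + N - al) %% N = 0 ->
  (r%:R ^+ 2 = al%:R :> 'F_N)%R.
Proof.
move=> N_pr al_lt /eqP; rewrite -/(N %| _) -natr_Fp_eq0 // natrB; last by lia.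
by rewrite natrD natrM (N0_Fp N_pr) addr0 subr_eq0 => /eqP.
Qed.

(** For prime N the current base or a smaller one is usable, so the search succeeds at 0 at the
    latest. The case [u = 0] is the start: no power is known yet and the test forces a round. *)
Lemma base_search_ok r n k al x y h u v a1 a2 a3 a4 a5 :
  al < N -> u = 0 \/ [/\ u < N, v < N & power_from al 1 0 r 1 t u v] ->
  r <= 2 * t + 3 ->
  (prime N -> usable_base al r u v \/ exists2 a, a < r &
     forall u v, power_from al 1 0 a 1 t u v -> usable_base al a u v) ->
  (forall r x y h u v w, (prime N -> usable_base al r u v) ->
    runs n k [:: N; t; e; al; x; y; h; u; v; r; a1; a2; a3; a4; w]) ->
  runs (r * (20 * b + 20) + 1 + n) (base_search :: k)
    [:: N; t; e; al; x; y; h; u; v; r; a1; a2; a3; a4; a5].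
Proof.
move=> al_lt; elim: r x y h u v a5 => [|r IHr] x y h u v a5 uv r_le base H.
  run_while; apply: (@runs_leq _ _ _ _ _ n); first by lia.
  by apply: H => N_pr; case: (base N_pr) => // -[].
run_while; case: ifPn => [test0|]; last first.
  rewrite negbK muln_eq0 /= subn_eq0 => test1; apply: (@runs_leq _ _ _ _ _ n); first by lia.
  apply: H => N_pr; case: uv => [u0|[uN vN pow]]; first by move: test1; rewrite u0; lia.
  move: test1; rewrite !muln_gt0 => /andP[/andP[u0 v0] d0]; split=> //.
  - by rewrite natr_Fp_eq0 // gtnNdvd.
  - by rewrite natr_Fp_eq0 // gtnNdvd.
  apply: contraTneq d0 => ral; rewrite -eqn0Ngt -/(N %| _) -natr_Fp_eq0 //.
  rewrite natrB; last by lia.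
  by rewrite natrD natrM (N0_Fp N_pr) addr0 -expr2 ral subrr.
rewrite mulSn; run_seq; run_assign; rewrite subn1 /=; do 3 (run_seq; run_assign).
apply: (@runs_leq _ _ _ _ _ (20 * b + 5 + (r * (20 * b + 20) + 1 + n))); first by lia.
apply: power_ok t_lt_b _ => x' y' u' v' a' u'N v'N pow.
apply: IHr => //; [by right|by lia|].
move=> N_pr; case: (base N_pr) => [[pow' u0 v0 ral]|[a a_lt Ha]].
  move: test0; rewrite muln_eq0 subn_eq0 /= -ltnNge ltnS leqn0 !muln_eq0 -orbA.
  case/or3P => /eqP z; first by rewrite z eqxx in u0.
    by rewrite z eqxx in v0.
  by rewrite (sub_modn_Fp N_pr al_lt z) eqxx in ral.
move: a_lt; rewrite ltnS leq_eqVlt => /orP[/eqP ar|a_lt]; last by right; exists a.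
by left; move: (Ha u' v'); rewrite ar; apply.
Qed.

Definition norm_invariant al j u v : Prop := exists s : 'F_N,
  [/\ s ^+ 2 = al%:R, s != 0 & opposite_squares_after s j u%:R v%:R]%R.

(** The counter strictly bounds the place in [opposite_squares_after], so for prime N it never
    reaches 0 and the loop ends with norm 0. For composite N the counter ensures termination. *)
Lemma norm_loop_ok j n k al u v a1 a2 a3 a4 a5 a6 a7 a8 :
  (prime N -> norm_invariant al j u v) ->
  (forall j u v w, (prime N -> norm_invariant al j u v) ->
     (prime N -> (u%:R ^+ 2 + al%:R * v%:R ^+ 2 = 0 :> 'F_N)%R) ->
     runs n k [:: N; t; e; al; a1; a2; a3; u; v; a4; a5; a6; a7; j; w]) ->
  runs (10 * j + 1 + n) (norm_loop :: k)
    [:: N; t; e; al; a1; a2; a3; u; v; a4; a5; a6; a7; j; a8].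
Proof.
elim: j u v a8 => [|j IHj] u v a8 inv H.
  run_while; apply: (@runs_leq _ _ _ _ _ n); first by lia.
  by apply: H => // N_pr; have [s [_ _ [_ _ []]]] := inv N_pr.
have normE : prime N ->
    ((u * u + al * (v * v)) %% N == 0) = (u%:R ^+ 2 + al%:R * v%:R ^+ 2 == 0 :> 'F_N)%R.
  by move=> N_pr; rewrite -/(N %| _) -natr_Fp_eq0 // natrD !natrM !expr2.
run_while; rewrite muln_eq0 /=; case: ifPn => [norm0|]; last first.
  rewrite negbK => norm0; apply: (@runs_leq _ _ _ _ _ n); first by lia.
  by apply: H => // N_pr; apply/eqP; rewrite -normE.
do 3 (run_seq; run_assign); run_assign; rewrite subn1 /=.
apply: runs_leq (IHj _ _ _ _ _); [by lia| |exact: H].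
move=> N_pr; have [s [sal s0 opp]] := inv N_pr; exists s; split=> //.
have := opposite_squares_step t_odd t_gt0 t_lt N_pr opp.
rewrite sal -normE // => /(_ norm0).
by rewrite !natr_modn ?N0_Fp // !(natrD, natrM) !expr2.
Qed.

Lemma square_root_ok n k al x y h u v a1 a2 a3 a4 a5 a6 :
  al < N -> 1 < e -> (prime N -> has_root al) ->
  (forall al' x y h u v r q j w, al' < N -> (prime N -> al'%:R ^+ 2 = - al%:R :> 'F_N)%R ->
    runs n k [:: N; t; e; al'; x; y; h; u; v; r; q; a3; a4; j; w]) ->
  runs ((2 * t + 3) * (20 * b + 20) + 10 * e + 20 * c + 40 + n) (square_root :: k)
    [:: N; t; e; al; x; y; h; u; v; a1; a2; a3; a4; a5; a6].
Proof.
move=> al_lt e_gt1 root H; rewrite /square_root; do 2 (run_seq; run_assign); run_seq.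
apply: (@runs_leq _ _ _ _ _ ((2 * t + 3) * (20 * b + 20) + 1 + (10 * e + 20 * c + 30 + n))).
  by move: (_ * (20 * b + 20)) => ?; lia.
apply: base_search_ok => //; first by left.
  by move=> N_pr; right; apply: usable_base_exists => //; apply: root.
move=> r1 x1 y1 h1 u1 v1 w1 use; run_seq; run_assign; run_seq.
apply: (@runs_leq _ _ _ _ _ (10 * e + 1 + (20 * c + 20 + n))); first by lia.
apply: norm_loop_ok => [N_pr|j u2 v2 w' inv norm0].
  have [s sal s0] := root N_pr; exists s; split=> //.
  have [pow u0 v0 ral] := use N_pr; have [HA HB] := power_from_conj N_pr sal pow.
  rewrite mul1r in HA; rewrite mul1r in HB.
  by apply: (opposite_squares_init t_gt0 t_lt N_pr HA HB); rewrite ?sal.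
do 4 (run_seq; run_assign); run_seq.
apply: (@runs_leq _ _ _ _ _ (20 * c + 5 + (5 + n))); first by lia.
apply: power_ok => [|x' y' u' v' a' u'N v'N pow]; first by lia.
run_assign; apply: (@runs_leq _ _ _ _ _ n); first by lia.
apply: H => // N_pr; have [s [sal s0 opp]] := inv N_pr.
have [HA HB] := power_from_conj N_pr sal pow.
rewrite mul0r addr0 in HA; rewrite mul0r subr0 in HB.
(* The base v has no X term, so both conjugate equations have the same right-hand side, and their
   sum eliminates v'. *)
have u'E : (u'%:R = v2%:R ^+ (N - 2) :> 'F_N)%R.
  have two0 : (2 != 0 :> 'F_N)%R := Fp_two_neq0 t_gt0 t_lt N_pr.
  apply: (mulfI two0).
  by rewrite !mulr_natl !mulr2n -{1}HA -HB; ring.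
rewrite natr_modn ?N0_Fp // natrM u'E -sal.
have := norm0 N_pr; rewrite -sal => norms.
by have := opposite_squares_sqrt t_odd t_gt0 t_lt N_pr opp s0 norms.
Qed.

(** With m rounds to go, -alpha has 2^(e-1-m)-th power -1. The new alpha' satisfies (-alpha')^2 =
    -alpha, which doubles the exponent. *)
Lemma root_loop_ok m n k al x y h u v a1 a2 a3 a4 a5 :
  al < N -> m < e -> (prime N -> (- al%:R) ^+ (2 ^ (e.-1 - m)) = -1 :> 'F_N)%R ->
  (forall al x y h u v r q j w, al < N ->
     (prime N -> (- al%:R) ^+ (2 ^ e.-1) = -1 :> 'F_N)%R ->
     runs n k [:: N; t; e; al; x; y; h; u; v; r; q; a3; 0; j; w]) ->
  runs (m * ((2 * t + 3) * (20 * b + 20) + 10 * e + 20 * c + 50) + 1 + n) (root_loop :: k)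
    [:: N; t; e; al; x; y; h; u; v; a1; a2; a3; m; a4; a5].
Proof.
have [K KE] : exists K, K = (2 * t + 3) * (20 * b + 20) + 10 * e + 20 * c + 50 by eexists.
have K50 : 50 <= K by rewrite KE leq_addl.
rewrite -KE.
elim: m al x y h u v a1 a2 a4 a5 => [|m IHm] al x y h u v a1 a2 a4 a5 al_lt m_lt alE H.
  run_while; apply: (@runs_leq _ _ _ _ _ n); first by lia.
  by apply: H => //; rewrite subn0 in alE.
rewrite mulSn; run_while; run_seq; run_assign; rewrite subn1 /=.
apply: (@runs_leq _ _ _ _ _ (K - 10 + (m * K + 1 + n))); first by lia.
have -> : K - 10 = (2 * t + 3) * (20 * b + 20) + 10 * e + 20 * c + 40 by lia.
 apply: square_root_ok => //.
- by lia.
- move=> N_pr; have [|s sal s0] := square_of_root t_odd t_gt0 t_lt N_pr _ (alE N_pr).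
    by lia.
  by exists s.
move=> al' x1 y1 h1 u1 v1 r q j w al'_lt al'E.
apply: IHm => // [|N_pr]; first by lia.
have -> : e.-1 - m = (e.-1 - m.+1).+1 by lia.
by rewrite expnS exprM sqrrN al'E // alE.
Qed.

(** A composite N may end with verdict 0 or 2, hence the two continuations. For prime N, as [t] is
    odd, -alpha has (t 2^(e-1))-th power -1, which excludes every verdict but 1. *)
Lemma root_of_unity_test_ok n k a1 a2 a3 a4 a5 a6 a7 a8 a9 a10 a11 :
  (forall al x y h u v r q m j w,
     runs n k [:: N; t; e; al; x; y; h; u; v; r; q; nat_of_bool (prime N); m; j; w] /\
     (~~ prime N -> runs n k [:: N; t; e; al; x; y; h; u; v; r; q; 2; m; j; w])) ->
  runs (e * ((2 * t + 3) * (20 * b + 20) + 10 * e + 20 * c + 50) + 20 * b + 10 * e + 50 + n)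
    (root_of_unity_test :: k)
    [:: N; t; e; a1; a2; a3; a4; a5; a6; a7; a8; 0; a9; a10; a11].
Proof.
have [K KE] : exists K, K = (2 * t + 3) * (20 * b + 20) + 10 * e + 20 * c + 50 by eexists.
have K50 : 50 <= K by rewrite KE leq_addl.
rewrite -KE => H.
rewrite /root_of_unity_test; do 2 (run_seq; run_assign); run_seq; rewrite subn1.
apply: (@runs_leq _ _ _ _ _ (e.-1 * K + 1 + (20 * b + 10 * e + 40 + n))).
  have -> : e * K = e.-1 * K + K by rewrite -{1}(prednK e_gt0) mulSn addnC.
  by move: (e.-1 * K) => ?; lia.
rewrite KE; apply: root_loop_ok => //; first by lia.
  by lia.
  by rewrite subnn expn0 expr1.
move=> al x y h u v r q j w al_lt alE; run_seq; run_assign.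
apply: (@runs_leq _ _ _ _ _ (20 * b + 10 * e + 30 + n)); first by lia.
apply: strong_test_ok => x1 y1 u1 v1 res j1 w1 test res_le.
have [H1 H2] := H 0 x1 y1 0 u1 v1 (N - al) q 0 j1 w1.
have N_pr_test : prime N -> N %| ((N - al) ^ (t * 2 ^ e.-1)).+1.
  move=> N_pr; rewrite -natr_Fp_eqN1 // natrX natrB; last by lia.
  by rewrite (N0_Fp N_pr) sub0r mulnC exprM alE // -signr_odd t_odd.
case: test => [ua|dvd|a1' no_m1].
- suff /negPf Npr : ~~ prime N by rewrite Npr in H1.
  have := undecided_fermat t_odd t_gt0 t_lt ua; rewrite -/N => a1'.
  apply/negP => /N_pr_test; rewrite -addn1 /dvdn -modnDml a1' modnDml.
  by move=> /dvdn_leq; lia.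
- have N_pr : prime N := proth_prime t_odd t_gt0 t_lt dvd.
  by rewrite N_pr in H1.
- apply: H2; apply/negP => N_pr; have lt_e : e.-1 < e by lia.
  by have := no_m1 _ lt_e; rewrite N_pr_test.
Qed.

Lemma factor_loop_ok i n k : i <= e ->
  runs n k [:: N; t; e; 0; 0; 0; 0; 0; 0; 0; 0; 0; 0; 0; 0] ->
  runs (10 * i + 1 + n) (factor_loop :: k)
    [:: N; t * 2 ^ i; e - i; 0; 0; 0; 0; 0; 0; 0; 0; 0; 0; 0; 0].
Proof.
elim: i => [|i IHi] ie H.
  run_while; rewrite expn0 muln1 subn0 modn2 oddD t_odd /=.
  by apply: (@runs_leq _ _ _ _ _ n); first by lia.
have ti : t * 2 ^ i <= N.
  rewrite /N; have : 2 ^ i <= 2 ^ e by rewrite leq_exp2l // ltnW.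
  by nia.
run_while; rewrite expnSr mulnA modn2 oddD !oddM andbF /=.
run_seq; apply: runs_assign => /=; [by lia|by move=> _; rewrite mulnK // /B; lia|].
apply: runs_assign => /=; [by lia|move=> _|].
  have : e < 2 ^ e by apply: ltn_expl.
  by rewrite /B /N; nia.
rewrite mulnK // (_ : e - i.+1 + 1 = e - i); last by lia.
by apply: runs_leq (IHi _ H); lia.
Qed.

End Deterministic.

(** * The random trials and the whole program *)

Local Notation answer := (nat_of_bool (prime N)).
Local Notation halts := (@halts_within R B answer).

Let finish : cmd := If ($11) Skip root_of_unity_test ;; 0 <~ $11 [%] Const 2.

Definition test_cost := 20 * b + 10 * e + 30.
Definition root_cost := e * ((2 * t + 3) * (20 * b + 20) + 10 * e + 20 * c + 50) + test_cost + 30.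

Lemma finish_known res T v l : all (leq^~ B) l -> res <= 2 -> res %% 2 = answer -> 0 < res ->
  nth 0 l 11 = res -> 10 <= T -> (10 <= v)%R -> halts T v ([:: finish], nth 0 l).
Proof.
move=> lB res2 res_ans res0 l11 T10 v10.
apply: (@halts_within_leq _ _ _ (10 + 0) _ (10 + 0)%R); rewrite ?addn0 ?addr0 //.
have : runs B answer 0 (0%R : R) 10 [:: finish] l; last by move/(_ lB); rewrite addn0 addr0.
rewrite /finish; run_seq; run_if; rewrite l11 -lt0n res0; run_skip.
apply: runs_assign => /=; [by lia|by move=> _; rewrite l11 res_ans; case: prime; rewrite /B; lia|].
move=> l'B; apply: halts_now; last by rewrite addr0 ler0n.
by rewrite nth_set_nth /= l11.
Qed.

Lemma finish_unknown T v a1 a2 a3 a4 a5 a6 a7 a8 a9 a10 a11 :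
  let l := [:: N; t; e; a1; a2; a3; a4; a5; a6; a7; a8; 0; a9; a10; a11] in
  all (leq^~ B) l -> root_cost <= T -> (root_cost%:R <= v)%R -> halts T v ([:: finish], nth 0 l).
Proof.
move=> l lB le_T le_v.
apply: (@halts_within_leq _ _ _ (root_cost + 0) _ (root_cost%:R + 0)%R); rewrite ?addn0 ?addr0 //.
have : runs B answer 0 (0%R : R) root_cost [:: finish] l; last by move/(_ lB); rewrite addn0 addr0.
rewrite /l /finish; have r30 : 30 <= root_cost by rewrite /root_cost leq_addl.
run_seq; run_if.
apply: runs_leq (root_of_unity_test_ok (n := 5) _).
  by rewrite /root_cost /test_cost; lia.
move=> al x y h u v' r q m j w; split=> [|N_pr].
  run_assign; move=> _; apply: halts_now => /=; last by rewrite addr0 ler0n.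
  by case: prime.
run_assign; move=> _; apply: halts_now => /=; last by rewrite addr0 ler0n.
by rewrite (negPf N_pr).
Qed.

(** With i digits to come, the outcomes r 2^i + s are equally likely, and [G] bounds the mean of
    what follows each. The condition on [q * 2 ^ j] excludes an earlier exit. *)
Lemma draw_loop_ok i T (G : nat -> R) k q r a1 a2 a3 a4 a5 a6 a7 a8 a9 w :
  let l r q w := [:: N; t; e; a1; a2; a3; a4; a5; a6; r; q; a7; a8; a9; w] in
  let Q := q * 2 ^ i in
  N <= Q -> Q <= 2 * N -> (forall j, j < i -> q * 2 ^ j < N) -> r < q ->
  all (leq^~ B) (l r q w) ->
  (forall r w, all (leq^~ B) (l r Q w) -> halts T (G r) (k, nth 0 (l r Q w))) ->
  halts (6 * i + 1 + T) ((6 * i + 1)%:R + (\sum_(s < 2 ^ i) G (r * 2 ^ i + s)%N) / 2 ^+ i)%R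
    (draw_loop :: k, nth 0 (l r q w)).
Proof.
elim: i q r w => [|i IHi] q r w l Q NQ QN q_lt rq lB H.
  have : runs B answer T (G r) 1 (draw_loop :: k) (l r q w).
    run_while; rewrite (_ : N - q = 0) /=; last by rewrite /Q in NQ; lia.
    have QE : Q = q by rewrite /Q muln1.
    by rewrite QE in H; rewrite /runs add0r add0n; apply: H.
  move=> /(_ lB); rewrite big_ord1 muln1 addn0 expr0 divr1 muln0 add0n.
  exact.
have q_N : q < N by have := q_lt 0 (ltn0Sn i); rewrite muln1.
set T' := 6 * i + 1 + T.
pose v' (bit : bool) := ((6 * i + 1)%:R +
  (\sum_(s < 2 ^ i) G ((r + r + bit) * 2 ^ i + s)%N) / 2 ^+ i : R)%R.
have after_flip (bit : bool) : runs B answer T' (v' bit) 3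
    [:: 9 <~ $9 [+] $9 [+] $14 ;; 10 <~ $10 [+] $10, draw_loop & k] (l r q bit).
  run_seq; apply: runs_assign => /=; [by lia|by case: bit; rewrite /B; lia|].
  apply: runs_assign => /=; [by lia|by rewrite /B; lia|].
  rewrite /runs add0r add0n => l'B; have qq : (q + q) * 2 ^ i = Q.
    by rewrite addnn -mul2n mulnC mulnA -expnSr mulnC.
  apply: IHi l'B _; rewrite ?qq //.
  - by move=> j ji; rewrite addnn -mul2n mulnC mulnA -expnSr mulnC; apply: q_lt.
  - by case: bit; lia.
have lB' (bit : bool) : all (leq^~ B) (l r q bit).
  have : bit <= B by case: bit; rewrite /B; lia.
  by move: lB => /=; do 14 (case/andP => ->); rewrite andbT => _ ->.
have : runs B answer (3 + T').+1 (1 + ((3%:R + v' false) + (3%:R + v' true)) / 2)%R 2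
    (draw_loop :: k) (l r q w).
  run_while; rewrite -lt0n subn_gt0 q_N; run_seq.
  rewrite /runs add0r add0n => _.
  apply: (@halts_step _ _ _ _ _ (3%:R + v' false) (3%:R + v' true)) => //.
  - by move=> j; apply: nth_bounded.
  - have := after_flip false (lB' false).
    by have <- : update (nth 0 (l r q w)) 14 0 = nth 0 (l r q false) by rewrite update_nth.
  - have := after_flip true (lB' true).
    by have <- : update (nth 0 (l r q w)) 14 1 = nth 0 (l r q true) by rewrite update_nth.
move=> /(_ lB); apply: halts_within_leq; first by rewrite /T'; lia.
(* The next digit splits the completions of r into those of 2 r and those of 2 r + 1. *)
rewrite expnS mul2n -addnn big_split_ord /= /v' /= addn0 [r + r + 1]addn1.
have -> : (\sum_(s < 2 ^ i) G (r * (2 ^ i + 2 ^ i) + s)%N =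
           \sum_(s < 2 ^ i) G ((r + r) * 2 ^ i + s)%N)%R.
  by apply: eq_bigr => s _; congr G; lia.
have -> : (\sum_(s < 2 ^ i) G (r * (2 ^ i + 2 ^ i) + (2 ^ i + s))%N =
           \sum_(s < 2 ^ i) G ((r + r).+1 * 2 ^ i + s)%N)%R.
  by apply: eq_bigr => s _; congr G; rewrite mulSn; lia.
set S0 := (\sum_(s < _) _)%R; set S1 := (\sum_(s < _) _)%R.
rewrite exprS !natrD !natrM -(natr1 i).
have : ((2 : R) ^+ i != 0)%R by rewrite expf_neq0 ?pnatr_eq0.
move: (2 ^+ i)%R => z z0.
have -> : ((S0 + S1) / (2 * z) = (S0 / z + S1 / z) / 2)%R by field.
lra.
Qed.

Lemma random_tests_known res a1 a2 a3 a4 a5 a6 a7 a8 m j w T v :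
  let l := [:: N; t; e; a1; a2; a3; a4; a5; a6; a7; a8; res; m; j; w] in
  all (leq^~ B) l -> res <= 2 -> res %% 2 = answer -> 0 < res ->
  12 <= T -> (12 <= v)%R -> halts T v ([:: random_tests; finish], nth 0 l).
Proof.
move=> l lB res2 res_ans res0 T12 v12.
apply: (@halts_within_leq _ _ _ (2 + 10) _ (2%:R + 10%:R)%R _ _ T12).
  by rewrite -natrD.
have : runs B answer 10 (10%:R : R) 2 [:: random_tests; finish] l; last by move/(_ lB).
run_while; have -> : 1 - res = 0 by lia.
rewrite muln0 /=; apply: (@runs_leq _ _ _ _ _ 0) => //.
by move=> _; rewrite add0n add0r; apply: (finish_known lB res2).
Qed.

(* [mean_bound] solves v (m + 1) = trial_cost + 3/4 v m: a trial is inconclusive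
   with probability at most 3/4. *)
Definition trial_cost := 6 * c + test_cost + 40.
Definition mean_bound m : R := (4 * trial_cost%:R + (3 / 4) ^+ m * root_cost%:R)%R.

Let trial_cost_ge : (40%:R <= trial_cost%:R :> R)%R.
Proof. by rewrite ler_nat /trial_cost leq_addl. Qed.

Let mean_bound_ge m : (160 <= mean_bound m)%R.
Proof.
have : (0 <= (3 / 4) ^+ m * root_cost%:R :> R)%R.
  by rewrite mulr_ge0 ?exprn_ge0 ?divr_ge0 ?ler0n.
move: trial_cost_ge; rewrite /mean_bound; move: (_ * root_cost%:R)%R (trial_cost%:R)%R => x y; lra.
Qed.

Lemma random_tests_ok m a1 a2 a3 a4 a5 a6 a7 a8 j w :
  let l := [:: N; t; e; a1; a2; a3; a4; a5; a6; a7; a8; 0; m; j; w] in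
  all (leq^~ B) l ->
  halts (trial_cost * m + root_cost + 40) (mean_bound m) ([:: random_tests; finish], nth 0 l).
Proof.
elim: m a1 a2 a3 a4 a5 a6 a7 a8 j w => [|m IHm] a1 a2 a3 a4 a5 a6 a7 a8 j w l lB.
  apply: (@halts_within_leq _ _ _ (1 + root_cost) _ (1%:R + root_cost%:R)%R); first by lia.
    by move: trial_cost_ge; rewrite /mean_bound expr0 mul1r mulr1n; lra.
  have : runs B answer root_cost (root_cost%:R : R) 1 [:: random_tests; finish] l; last by move/(_ lB).
  run_while; apply: (@runs_leq _ _ _ _ _ 0) => // _.
  by rewrite add0n add0r; apply: finish_unknown.
(* [2 ^ L] is the least power of two not below N; it is at most 2 (N - 1), as [sum_inconclusive]
   requires. *)
pose L := bitlen N.-1.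
have NL : N <= 2 ^ L by have := ltn_bitlen N.-1; rewrite -/L; lia.
have LN : 2 ^ L.-1 <= N.-1 by apply: trunc_logP; lia.
have L2 : 2 ^ L = 2 * 2 ^ L.-1 by rewrite -expnS.
have Lc : L <= c.
  apply: bitlen_ub; last by lia.
  by case: (c) N_lt_c => //; rewrite expn0; lia.
set Tm := trial_cost * m + root_cost + 40 in IHm *.
pose w0 r : R := if inconclusive e t r then mean_bound m else 12%:R.
pose G r : R := ((test_cost + 10)%:R + w0 r)%R.
have after_draw r w' : all (leq^~ B) [:: N; t; e; a1; a2; a3; a4; a5; a6; r; 2 ^ L; 0; m; j; w'] ->
    halts (test_cost + 10 + Tm) (G r) ([:: If ($9 [%] $0) strong_test Skip; random_tests; finish],
      nth 0 [:: N; t; e; a1; a2; a3; a4; a5; a6; r; 2 ^ L; 0; m; j; w']).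
  suff : runs B answer Tm (w0 r) (test_cost + 10)
    [:: If ($9 [%] $0) strong_test Skip; random_tests; finish]
    [:: N; t; e; a1; a2; a3; a4; a5; a6; r; 2 ^ L; 0; m; j; w'] by [].
  run_if; case: ifPn => [rN|]; last first.
    rewrite negbK => rN; run_skip; apply: (@runs_leq _ _ _ _ _ 0) => // lB'.
    by rewrite add0n add0r /w0 /inconclusive -/N /dvdn rN; apply: IHm.
  apply: (@runs_leq _ _ _ _ _ (test_cost + 0)); first by lia.
  apply: strong_test_ok => x y u v res j' w1 test res2 lB'; rewrite add0n add0r.
  have w0_ge : (12%:R <= w0 r)%R.
    rewrite /w0; case: ifP => // _; apply: le_trans (mean_bound_ge m).
    by rewrite ler_nat.
  case: test lB' res2 => [ur|dvd|rt no_m1] lB' res2.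
  - by rewrite /w0 /inconclusive ur orbT; apply: IHm.
  - have N_pr : prime N := proth_prime t_odd t_gt0 t_lt dvd.
    by apply: random_tests_known => //; [rewrite N_pr|rewrite /Tm; lia].
  - have N_npr : prime N = false.
      apply/negP => N_pr; have [|[i lt_i dvd]] := strong_test_prime t_gt0 t_lt N_pr rN.
        by rewrite -/N (negPf rt).
      by move: (no_m1 i lt_i); rewrite dvd.
    by apply: random_tests_known => //; [rewrite N_npr|rewrite /Tm; lia].
pose S := (\sum_(s < 2 ^ L) G (0 * 2 ^ L + s)%N)%R.
have : runs B answer (6 * L + 1 + (test_cost + 10 + Tm)) ((6 * L + 1)%:R + S / 2 ^+ L)%R 8
    [:: random_tests; finish] l.
  run_while; do 3 (run_seq; run_assign); run_seq; rewrite subn1 /=.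
  apply: (@runs_leq _ _ _ _ _ 0) => // lB'; rewrite add0n add0r.
  apply: draw_loop_ok => //.
  - by rewrite mul1n.
  - by rewrite mul1n; lia.
  - move=> i lt_i; rewrite mul1n.
    have : 2 ^ i <= 2 ^ L.-1 by rewrite leq_exp2l //; lia.
    by lia.
  - by rewrite mul1n; apply: after_draw.
move=> /(_ lB); apply: halts_within_leq; first by rewrite /Tm mulnS /trial_cost; lia.
(* 22 is the 10 of [G] plus the 12 that suffice after a verdict; inconclusive draws, at most 3/4 of
   all, also pay [mean_bound m]. *)
have SE : (S <= (test_cost + 22)%:R * 2 ^+ L + 3 / 4 * 2 ^+ L * mean_bound m)%R.
  have inc : (\sum_(s < 2 ^ L) (inconclusive e t s)%:R <= 3 / 4 * 2 ^+ L :> R)%R.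
    have le_2N : 2 ^ L <= 2 * (2 ^ e * t + 1).-1 by rewrite -/N; lia.
    have := sum_inconclusive t_odd t_gt0 t_lt NL le_2N.
    rewrite -(ler_nat R) !natrM natr_sum natrX; lra.
  apply: (@le_trans _ _ (\sum_(s < 2 ^ L) ((test_cost + 22)%:R +
      (inconclusive e t s)%:R * mean_bound m))%R).
    apply: ler_sum => s _; rewrite /G /w0 mul0n add0n !natrD.
    by have := mean_bound_ge m; case: inconclusive => /= ?; lra.
  rewrite big_split /= sumr_const card_ord -[(_ *+ (2 ^ L))%R]mulr_natr natrX lerD2l.
  rewrite -mulr_suml ler_wpM2r //; have := mean_bound_ge m; lra.
have z0 : (0 < (2 : R) ^+ L)%R by rewrite exprn_gt0.
have {}SE : (S / 2 ^+ L <= (test_cost + 22)%:R + 3 / 4 * mean_bound m)%R.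
  by rewrite ler_pdivrMr // mulrDl mulrAC.
have Lc' : (L%:R <= c%:R :> R)%R by rewrite ler_nat.
rewrite /mean_bound exprS /trial_cost !(natrD, natrM) in SE *; lra.
Qed.

Lemma proth_test_ok :
  halts (trial_cost * e + root_cost + 10 * e + 60) ((10 * e + 20)%:R + mean_bound e)%R
    (init proth_test N).
Proof.
pose l := [:: N; 0; 0; 0; 0; 0; 0; 0; 0; 0; 0; 0; 0; 0; 0].
have -> : init proth_test N = ([:: proth_test], nth 0 l).
  congr pair; apply/funext => i; rewrite /update.
  by do 15 (case: i => [|i] //); case: i.
have : runs B answer (trial_cost * e + root_cost + 40) (mean_bound e) (10 * e + 20)
    [:: proth_test] l.
  rewrite /proth_test -/finish; run_seq; run_assign; run_seq.
  apply: (@runs_leq _ _ _ _ _ (10 * e + 1 + 10)); first by lia.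
  have -> : N - 1 = t * 2 ^ e by rewrite /N addnK mulnC.
  have := factor_loop_ok (leqnn e); rewrite subnn; apply.
  run_seq; apply: runs_assign => /=; [by lia| |].
    move=> _; have : e < 2 ^ e by apply: ltn_expl.
    by rewrite /B /N; nia.
  run_seq; apply: (@runs_leq _ _ _ _ _ 0) => // lB.
  by rewrite add0n add0r; apply: random_tests_ok.
have lB : all (leq^~ B) l by rewrite /= /B leq_pmull.
by move=> /(_ lB); apply: halts_within_leq => //; lia.
Qed.

End ProgramCorrectness.

(** * Asymptotics *)

Section Asymptotics.
Variable R : realType.

Lemma ln2_gt0 : 0 < ln 2 :> R.
Proof. by rewrite ln_gt0 // ltr1n. Qed.

Lemma ln_nat_ge0 n : 0 <= ln n%:R :> R.
Proof. by case: n => [|n]; [rewrite ln0|rewrite ln_ge0 // ler1n]. Qed.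

Lemma ler_ln_nat m n : (0 < m)%N -> (m <= n)%N -> ln m%:R <= ln n%:R :> R.
Proof. by move=> m0 mn; rewrite ler_ln ?ler_nat // posrE ltr0n // (leq_trans m0). Qed.

Lemma bitlen_ln n : (1 < n)%N -> (bitlen n)%:R <= 2 / ln 2 * ln n%:R :> R.
Proof.
move=> n1; rewrite mulrAC ler_pdivlMr ?ln2_gt0 // /bitlen -natr1 mulrDl mul1r.
have : (trunc_log 2 n)%:R * ln 2 <= ln n%:R :> R.
  rewrite mulr_natl -lnXn ?ltr0n // -natrX ler_ln_nat ?expn_gt0 //.
  by rewrite trunc_logP // ltnW.
have := ler_ln_nat (isT : (0 < 2)%N) n1; lra.
Qed.

(** The finitely many values below [n0] go into the constant; the summand 1 keeps the bound from
    vanishing at X = 1. The other values use that X ln^c X grows with X. *)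
Lemma soft_linear_max (M : nat -> nat) :
  soft_O id (fun n : nat => (M n)%:R%:E) (fun n : nat => n%:R : R) ->
  exists c : nat, exists2 C : R, 0 <= C & forall X : nat, (0 < X)%N ->
    (\max_(m < X.+1) M m)%:R <= C * (X%:R * (1 + ln X%:R ^+ c)).
Proof.
move=> [c [n0 [C HC]]]; set C0 := (\max_(i < n0) M i)%N.
have C00 : 0 <= C0%:R + `|C| by rewrite addr_ge0.
exists c; exists (C0%:R + `|C|) => // X X0.
have [|i ->] := @bigop.eq_bigmax 'I_X.+1 (fun m => M m); first by rewrite card_ord.
have X1 : 1 <= X%:R :> R by rewrite ler1n.
have lnX : 0 <= ln X%:R ^+ c :> R by rewrite exprn_ge0 ?ln_nat_ge0.
have [lt_i|le_i] := ltnP i n0.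
  have : (M i)%:R <= C0%:R :> R by rewrite ler_nat (leq_bigmax (Ordinal lt_i)).
  have : C0%:R * 1 <= (C0%:R + `|C|) * (X%:R * (1 + ln X%:R ^+ c)).
    rewrite ler_pM ?ler0n ?ler01 ?lerDl // mulr_ege1 // lerDl //.
  by rewrite mulr1 => /(le_trans _); apply.
have := HC i le_i; rewrite lee_fin => /le_trans; apply.
have i_X : i%:R <= X%:R :> R by rewrite ler_nat -ltnS ltn_ord.
have ln_i : ln i%:R ^+ c <= ln X%:R ^+ c :> R \/ i = 0%N :> nat.
  case: (posnP i) => [|i0]; [by right|left].
  by rewrite lerXn2r ?nnegrE ?ln_nat_ge0 // ler_ln_nat // -ltnS.
apply: (@le_trans _ _ (`|C| * (X%:R * (1 + ln X%:R ^+ c)))); last first.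
  by rewrite ler_wpM2r ?lerDr // mulr_ge0 ?addr_ge0.
apply: (@le_trans _ _ (`|C| * (i%:R * ln i%:R ^+ c))).
  by rewrite ler_wpM2r ?ler_norm // mulr_ge0 // exprn_ge0 ?ln_nat_ge0.
rewrite ler_wpM2l //; case: ln_i => [ln_i|->]; last by rewrite mul0r mulr_ge0 // addr_ge0.
rewrite ler_pM // ?exprn_ge0 ?ln_nat_ge0 //.
by apply: le_trans ln_i _; rewrite lerDr.
Qed.

(** The deterministic search takes O(e W) steps but is reached with probability at most (3/4)^e;
    this bound removes the factor e from the mean. From n = 3 on the product no longer increases. *)
Lemma three_quarters_exp_mul_le n : (3 / 4 : R) ^+ n * n%:R <= 3.
Proof.
elim: n => [|n IHn]; first by rewrite mulr0.
have [n3|n3] := leqP 3 n; last first.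
  by case: n n3 IHn => [|[|[|n]]] // _ _; rewrite !exprS expr0; lra.
have x0 : 0 <= (3 / 4 : R) ^+ n by rewrite exprn_ge0.
rewrite exprS -mulrA -(natr1 n); have {n3} : 3%:R <= n%:R :> R by rewrite ler_nat.
move: (_ ^+ n) (n%:R) x0 IHn => x y x0 xy y3.
have : x * 3 <= x * y by rewrite ler_wpM2l.
lra.
Qed.

End Asymptotics.

(** * Step counts in terms of W = t b + c, with b and c the bit lengths of t and N *)

Section StepBounds.
Local Open Scope nat_scope.
Variables (e t : nat).
Hypotheses (t_gt0 : 0 < t) (t_lt : t < 2 ^ e).
Let N := 2 ^ e * t + 1.
Let b := bitlen t.
Let c := bitlen N.
Let W := t * b + c.

Let b_gt0 : 0 < b. Proof. by []. Qed.

Let e_lt_c : e < c.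
Proof.
rewrite -(ltn_exp2l _ _ (isT : 1 < 2)); apply: leq_ltn_trans (ltn_bitlen N).
by rewrite /N (leq_trans _ (leq_addr _ _)) // leq_pmulr.
Qed.

Lemma root_cost_le : root_cost e t b c <= e * (200 * W) + 100 * W.
Proof.
rewrite /root_cost /test_cost.
(* Here 2 t + 3 <= 5 t and 20 b + 20 <= 40 b. *)
have : (2 * t + 3) * (20 * b + 20) <= 200 * (t * b) by nia.
have tb : 0 < t * b by rewrite muln_gt0 t_gt0.
have bt : b <= t * b by rewrite leq_pmull.
move: e_lt_c; move: (_ * (20 * b + 20)) => x; rewrite /W; nia.
Qed.

Lemma trial_cost_le : trial_cost e b c <= 100 * W.
Proof.
rewrite /trial_cost /test_cost; have bt : b <= t * b by rewrite leq_pmull.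
have tb : 0 < t * b by rewrite muln_gt0 t_gt0.
by move: e_lt_c; rewrite /W; lia.
Qed.

Lemma worst_steps_le :
  trial_cost e b c * e + root_cost e t b c + 10 * e + 60 <= 500 * c * W.
Proof.
have := root_cost_le; have := trial_cost_le.
have tb : 0 < t * b by rewrite muln_gt0 t_gt0.
have : W * e + W <= W * c by rewrite -mulnSr leq_mul2l e_lt_c orbT.
have : 1 <= W by rewrite /W; lia.
have : e <= W by move: e_lt_c; rewrite /W; lia.
move: (root_cost _ _ _ _) (trial_cost _ _ _) W => x y w; nia.
Qed.

Lemma mean_steps_le (R : realType) :
  ((10 * e + 20)%:R + mean_bound e t b c R e <= (1300 * W)%:R :> R)%R.
Proof.
have tb : 0 < t * b by rewrite muln_gt0 t_gt0.
have W1 : (1 <= W%:R :> R)%R by rewrite ler1n /W; lia.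
have eW : (e%:R <= W%:R :> R)%R by rewrite ler_nat; move: e_lt_c; rewrite /W; lia.
have trial : ((trial_cost e b c)%:R <= 100%:R * W%:R :> R)%R.
  by rewrite -natrM ler_nat trial_cost_le.
(* 700 = 3 * 200 + 100, where 3 bounds (3/4)^e e. *)
have root : ((3 / 4 : R) ^+ e * (root_cost e t b c)%:R <= 700%:R * W%:R)%R.
  have x0 : (0 <= (3 / 4 : R) ^+ e)%R by rewrite exprn_ge0.
  have x1 : ((3 / 4 : R) ^+ e <= 1)%R by rewrite exprn_ile1 //; lra.
  have : ((root_cost e t b c)%:R <= e%:R * (200%:R * W%:R) + 100%:R * W%:R :> R)%R.
    by rewrite -!natrM -natrD ler_nat root_cost_le.
  move=> /(ler_wpM2l x0) /le_trans; apply; have := three_quarters_exp_mul_le R e.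
  move: (_ ^+ e)%R x0 x1 (e%:R)%R (W%:R)%R W1 => x x0 x1 e' w w1; nra.
rewrite /mean_bound natrD !natrM; move: (_ * (root_cost _ _ _ _)%:R)%R root => y; lra.
Qed.

End StepBounds.

(** * From bit lengths to logarithms *)

Section SoftBounds.
Variable R : realType.

Lemma bitlen_sum_le t n : (0 < t)%N -> (1 < n)%N ->
  (t * bitlen t + bitlen n)%:R <= 4 / ln 2 * (t%:R * ln t%:R + ln n%:R) :> R.
Proof.
move=> t0 n1; have l2 : 0 < 2 / ln 2 :> R by rewrite divr_gt0 ?ln2_gt0.
have bn := bitlen_ln R n1; have tl : 0 <= t%:R * ln t%:R :> R by rewrite mulr_ge0 ?ln_nat_ge0.
have -> : 4 / ln 2 = 2 * (2 / ln 2) :> R by rewrite mulrA -natrM.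
have : t%:R * (bitlen t)%:R <= 2 / ln 2 * (t%:R * ln t%:R) + 2 / ln 2 * ln n%:R :> R.
  have l2tl : 0 <= 2 / ln 2 * (t%:R * ln t%:R) :> R by rewrite mulr_ge0 // ltW.
  have l2n : 0 <= 2 / ln 2 * ln n%:R :> R by rewrite mulr_ge0 ?ln_nat_ge0 // ltW.
  (* At t = 1 the term t ln t vanishes while [bitlen 1] is 1; ln n absorbs it, which doubles the
     constant. *)
  have [t1|t1] := leqP t 1.
    have -> : t = 1%N by apply/eqP; rewrite eqn_leq t1.
    rewrite ln1 mulr0 mulr0 add0r mul1r (le_trans _ bn) // ler_nat.
    exact: leq_bitlen (ltnW n1).
  rewrite (@le_trans _ _ (2 / ln 2 * (t%:R * ln t%:R))) ?lerDl //.
  by rewrite mulrCA ler_wpM2l // bitlen_ln.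
have : 0 <= 2 / ln 2 * (t%:R * ln t%:R) :> R by rewrite mulr_ge0 // ltW.
rewrite natrD natrM; move: (2 / ln 2) (t%:R * ln t%:R) bn => x y; nra.
Qed.

(** Here [g] is the time bound to be proved. The operand length X is O(ln n), so ln X <= ln k + ln
    (ln n) for a constant k; as ln g >= 1, this is at most a constant times ln g. *)
Lemma step_bound_soft (M : nat -> nat) (K : nat) : (0 < K)%N ->
  soft_O id (fun n : nat => (M n)%:R%:E) (fun n : nat => n%:R : R) ->
  exists c : nat, exists2 C : R, 0 <= C & forall (n : nat) (g : R),
    (1 < n)%N -> expR 1 <= ln n%:R :> R -> ln n%:R <= g ->
    (2 * K * op_bound M (bitlen (4 * n)) K)%:R <= C * (ln n%:R * ln g ^+ c).
Proof.
move=> K0 /soft_linear_max[c [Cm Cm0 maxM]].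
have l2 := ln2_gt0 R; pose k : R := K%:R * (8 / ln 2).
have k0 : 0 < k by rewrite mulr_gt0 ?divr_gt0 ?ltr0n.
pose k' : R := `|ln k| + 1; have k'0 : 0 <= k' by rewrite addr_ge0.
have kc : 0 <= k' ^+ c by rewrite exprn_ge0.
exists c; exists (2 * K%:R * (k * (2 + Cm * (1 + k' ^+ c)))).
  have K0' : 0 <= 2 * K%:R :> R by rewrite mulr_ge0.
  by apply: (mulr_ge0 K0'); rewrite mulr_ge0 ?ltW // ltr_wpDr ?mulr_ge0 ?addr_ge0.
move=> n g n1 len leg; set X := (K * bitlen (4 * n))%N.
have ln_n0 : 0 < ln n%:R :> R by apply: lt_le_trans len; apply: expR_gt0.
have Xk : X%:R <= k * ln n%:R.
  rewrite /X natrM /k -mulrA ler_wpM2l //.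
  have := bitlen_ln R n1; have : (bitlen (4 * n) <= 4 * bitlen n)%N.
    have := bitlenM 4 n; have -> : bitlen 4 = 3 by [].
    by have : (0 < bitlen n)%N by []; lia.
  rewrite -(ler_nat R) natrM => /le_trans + le_n; apply.
  by have -> : 8 / ln 2 * ln n%:R = 4 * (2 / ln 2 * ln n%:R) :> R; [ring|rewrite ler_wpM2l].
have X0 : (0 < X)%N by rewrite muln_gt0 K0.
have lng1 : 1 <= ln g.
  rewrite -[leLHS]expRK ler_ln ?posrE ?expR_gt0 //; first exact: le_trans leg.
  by apply: lt_le_trans leg.
have lnX : ln X%:R <= k' * ln g.
  apply: (@le_trans _ _ (ln (k * ln n%:R))).
    by rewrite ler_ln ?posrE ?ltr0n // mulr_gt0.
  rewrite lnM ?posrE // /k' mulrDl mul1r lerD //; last first.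
    by rewrite ler_ln ?posrE // (lt_le_trans ln_n0).
  apply: le_trans (ler_norm _) _; rewrite -[leLHS]mulr1 ler_wpM2l //.
have lnXc : ln X%:R ^+ c <= k' ^+ c * ln g ^+ c.
  rewrite -exprMn lerXn2r // nnegrE ?ln_nat_ge0 //.
  by apply: le_trans lnX; apply: ln_nat_ge0.
have lngc : 1 <= ln g ^+ c by rewrite exprn_ege1.
have := maxM X X0; rewrite /op_bound -/X; move: (\max_(m < _) _)%N => mx le_mx.
have kX : 0 <= k * ln n%:R by rewrite mulr_ge0 ?ltW.
have le_M : Cm * (X%:R * (1 + ln X%:R ^+ c)) <=
    Cm * (k * ln n%:R * ((1 + k' ^+ c) * ln g ^+ c)).
  rewrite ler_wpM2l // ler_pM // ?addr_ge0 ?exprn_ge0 ?ln_nat_ge0 //.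
  by rewrite mulrDl mul1r lerD.
have le_X : X%:R <= k * ln n%:R * ln g ^+ c by rewrite (le_trans Xk) // ler_peMr.
have -> : 2 * K%:R * (k * (2 + Cm * (1 + k' ^+ c))) * (ln n%:R * ln g ^+ c) =
    2 * K%:R * (2 * (k * ln n%:R * ln g ^+ c) +
                Cm * (k * ln n%:R * ((1 + k' ^+ c) * ln g ^+ c))) by ring.
rewrite natrM [(2 * K)%:R]natrM ler_wpM2l ?mulr_ge0 // natrD natrM lerD ?ler_wpM2l //.
by apply: le_trans le_mx le_M.
Qed.

End SoftBounds.

Lemma proth_test_time : exists A : nat,
  forall (R : realType) (M : nat -> nat) (N : proth),
  let t := proth_t N in
  let W := (t * bitlen t + bitlen N)%N in
  let U := (2 * cmd_size proth_test * op_bound M (bitlen (4 * N)) (cmd_size proth_test))%N in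
  (expected_time R M proth_test N <= (U%:R * (A%:R * W%:R))%:E)%E /\
  (worst_time R M proth_test N <= (U%:R * (A%:R * (bitlen N)%:R * W%:R))%:E)%E.
Proof.
have [A A_mean A_worst] : exists2 A, (1300 <= A)%N & (500 <= A)%N by exists 1300%N.
exists A => R M N t W; have /andP[t0 t_lt] := proth_bound N.
have t_odd := proth_odd N; move=> U; have leK := leqnn (cmd_size proth_test).
have H := proth_test_ok t_odd t0 t_lt (ltn_bitlen _) (ltn_bitlen _) R.
split.
  have /le_trans := expected_time_le M H leK; apply; rewrite lee_fin ler_wpM2l //.
  have /le_trans := mean_steps_le t0 t_lt R; apply.
  by rewrite -natrM ler_nat leq_mul2r A_mean orbT.
have /le_trans := worst_time_le M H leK; apply; rewrite lee_fin -!natrM ler_nat leq_mul2l.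
apply/orP; right; have /leq_trans := worst_steps_le t0 t_lt; apply.
by rewrite -!mulnA leq_mul2r A_worst orbT.
Qed.

Theorem theorem1p5 (R : realType) :
  exists P : cmd,
    (forall N : proth, answers P N (prime N)) /\
    (forall M : nat -> nat,
       soft_O id (fun n : nat => (M n)%:R%:E) (fun n : nat => n%:R : R) ->
       soft_O proth_val
         (fun N : proth => expected_time R M P N)
         (fun N : proth =>
            ((proth_t N)%:R * ln (proth_t N)%:R + ln N%:R) * ln N%:R) /\
       soft_O proth_val
         (fun N : proth => worst_time R M P N)
         (fun N : proth =>
            ((proth_t N)%:R * ln (proth_t N)%:R + ln N%:R) * ln N%:R ^+ 2)).
Proof.
exists proth_test; split=> [N w|M softM].
  have /andP[t0 t_lt] := proth_bound N.
  have := proth_test_ok (proth_odd N) t0 t_lt (ltn_bitlen _) (ltn_bitlen _) R.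
  move=> /(halts_withinP w)[n]; rewrite -run_fromE => Hn.
  by exists n.
have K0 : (0 < cmd_size proth_test)%N by [].
have [c [C C0 stepC]] := step_bound_soft K0 softM.
(* Above exp (exp 1), ln N is at least e, so that ln g >= 1. *)
pose n0 := (Num.bound (expR (expR 1) : R)).+2.
have large (N : proth) : (n0 <= N)%N ->
    [/\ (1 < N)%N, expR 1 <= ln N%:R :> R & 0 <= (proth_t N)%:R * ln (proth_t N)%:R :> R].
  move=> n0N; split; first by apply: leq_trans n0N.
    rewrite -[leLHS]expRK ler_ln ?posrE ?expR_gt0 ?ltr0n //; last by apply: leq_trans n0N.
    apply/ltW/(lt_le_trans (archi_boundP (expR_ge0 _))).
    by rewrite ler_nat (leq_trans _ n0N) // /n0; lia.
  by rewrite mulr_ge0 ?ln_nat_ge0.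
have [A timeA] := proth_test_time.
have l2 := ln2_gt0 R; have e1 : 1 <= expR 1 :> R by have := expR_ge1Dx (1 : R); lra.
split.
  (* The factor ln N of g, with the power of ln g, pays for one step; the remaining factor pays for
     the mean number of steps. *)
  exists c, n0, (C * (A%:R * (4 / ln 2))) => N n0N.
  have [N1 eN tl] := large N n0N.
  have [+ _] := timeA R M N; move=> /le_trans; apply; rewrite lee_fin.
  have /andP[t0 _] := proth_bound N; have := bitlen_sum_le R t0 N1.
  set H := _ * _ + _; set W := (_ + _)%N; set g := H * _ => W_le.
  have lnN0 : 0 < ln N%:R :> R by lra.
  have le_g : ln N%:R <= g by rewrite ler_peMl ?(ltW lnN0) // /H; lra.
  have := stepC N g N1 eN le_g; move: (_ * op_bound _ _ _)%N => U U_le.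
  have -> : C * (A%:R * (4 / ln 2)) * (g * ln g ^+ c) =
      C * (ln N%:R * ln g ^+ c) * (A%:R * (4 / ln 2 * H)) by rewrite /g; ring.
  have AW : A%:R * W%:R <= A%:R * (4 / ln 2 * H) :> R by apply: ler_wpM2l.
  by apply: ler_pM U_le AW; rewrite ?mulr_ge0.
exists c, n0, (C * (A%:R * (2 / ln 2) * (4 / ln 2))) => N n0N.
have [N1 eN tl] := large N n0N.
have [_ +] := timeA R M N; move=> /le_trans; apply; rewrite lee_fin.
have /andP[t0 _] := proth_bound N; have := bitlen_sum_le R t0 N1.
set H := _ * _ + _; set W := (_ + _)%N; set g := H * _ => W_le.
have lnN0 : 0 < ln N%:R :> R by lra.
have lnN1 : 1 <= ln N%:R :> R by lra.
have le_g : ln N%:R <= g.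
  by rewrite /g expr2 mulrA ler_peMl ?(ltW lnN0) // -[leLHS]mulr1 ler_pM // /H; lra.
have := stepC N g N1 eN le_g; move: (_ * op_bound _ _ _)%N => U U_le.
have -> : C * (A%:R * (2 / ln 2) * (4 / ln 2)) * (g * ln g ^+ c) =
    C * (ln N%:R * ln g ^+ c) * (A%:R * (2 / ln 2 * ln N%:R) * (4 / ln 2 * H)).
  by rewrite /g; ring.
have Ab : A%:R * (bitlen N)%:R <= A%:R * (2 / ln 2 * ln N%:R) :> R.
  by apply: ler_wpM2l => //; apply: bitlen_ln.
have AbW : A%:R * (bitlen N)%:R * W%:R <= A%:R * (2 / ln 2 * ln N%:R) * (4 / ln 2 * H) :> R.
  by apply: ler_pM Ab W_le; rewrite ?mulr_ge0.
by apply: ler_pM U_le AbW; rewrite ?mulr_ge0.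
Qed.
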